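(* Let $G$ be a totally disconnected locally compact group and $\phi:G\to G$ a continuous endomorphism. Then $$\log s(\phi)=h_{top}(\bar\phi),$$ where $\bar\phi:G/\mathrm{nub}(\phi)\to G/\mathrm{nub}(\phi)$, $x\,\mathrm{nub}(\phi)\mapsto\phi(x)\,\mathrm{nub}(\phi)$, is the map induced by $\phi$ on left cosets.
   Context: All topological groups are Hausdorff; $\mathbb N$ contains $0$. Let $\mathcal B(G)$ be the family of compact open subgroups of the totally disconnected locally compact group $G$. The scale of $\phi$ is $s(\phi)=\min\{[\phi U:U\cap\phi U]:U\in\mathcal B(G)\}$ (a positive integer). A subgroup $U\in\mathcal B(G)$ is minimizing if $s(\phi)=[\phi U:U\cap\phi U]$, and $\mathrm{nub}(\phi)$ is the intersection of all minimizing $U\in\mathcal B(G)$. It is known that $\mathrm{nub}(\phi)$ is compact and $\phi(\mathrm{nub}(\phi))=\mathrm{nub}(\phi)$. Topological entropy of the map $\bar\phi:G/H\to G/H$, for a compact (not necessarily normal) subgroup $H$ with $\phi(H)\leq H$: let $\pi:G\to G/H$ be the canonical projection onto the space of left cosets, and let $\bar\mu$ be a Borel measure on $G/H$ invariant under left translations $xH\mapsto gxH$ ($g\in G$), finite on compact sets and positive on some compact set (it exists). For $K\in\mathcal B(G)$ with $H\leq K$ put $(\pi K)_{-n}=\pi K\cap\bar\phi^{-1}(\pi K)\cap\dots\cap\bar\phi^{-n}(\pi K)$ and $H_{top}(\bar\phi,\pi K)=\limsup_{n\to\infty}-\frac1n\log\bar\mu((\pi K)_{-n})$. Then $h_{top}(\bar\phi)=\sup\{H_{top}(\bar\phi,\pi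 K):K\in\mathcal B(G),\ H\leq K\}\in[0,\infty]$. *)

(* Defs.v *)
From HB Require Import structures.
From mathcomp Require Import all_boot all_order all_algebra.
From mathcomp Require Import generic_quotient finmap.
From mathcomp Require Import all_classical all_reals all_analysis.

Set Implicit Arguments.
Unset Strict Implicit.
Unset Printing Implicit Defensive.

Import Order.TTheory GRing.Theory Num.Theory.
Import numFieldNormedType.Exports.

Local Open Scope classical_set_scope.
Local Open Scope quotient_scope.
Local Open Scope ring_scope.

HB.mixin Record Group_isTopologicalGroup G & Topological G & Group G := {
  mulg_continuous : continuous (fun z : G * G => (z.1 * z.2)%g) ;
  invg_continuous : continuous (fun x : G => (x^-1)%g)
}.

#[short(type="topologicalGroupType")]
HB.structure Definition TopologicalGroup :=
  {G of Topological G & Group G & Group_isTopologicalGroup G}.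

Definition is_subgroup (G : groupType) (H : set G) : Prop :=
  group_closed (mem H).

Record subgroup (G : groupType) := Subgroup {
  subgroup_set :> set G ;
  subgroupP : is_subgroup subgroup_set
}.

Section coset_space.
Variables (G : topologicalGroupType) (H : subgroup G).

(* x H = y H iff x^-1 y lies in H *)
Definition lcoset_rel : rel G := fun x y => (x^-1 * y)%g \in (H : set G).

Let subgroup1 : 1%g \in (H : set G).
Proof. by case: (subgroupP H). Qed.

Let subgroupF x y : x \in (H : set G) -> y \in (H : set G) ->
  (x / y)%g \in (H : set G).
Proof. by case: (subgroupP H) => _; apply. Qed.

Let subgroupV x : x \in (H : set G) -> (x^-1)%g \in (H : set G).
Proof. by move=> Hx; rewrite -[(x^-1)%g]mul1g; exact: subgroupF. Qed.

Let lcoset_refl : reflexive lcoset_rel.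
Proof. by move=> x; rewrite /lcoset_rel mulVg. Qed.

Let lcoset_sym : symmetric lcoset_rel.
Proof.
suff sub x y : lcoset_rel x y -> lcoset_rel y x.
  by move=> x y; apply/idP/idP; exact: sub.
by move=> /subgroupV; rewrite invgM invgK.
Qed.

Let lcoset_trans : transitive lcoset_rel.
Proof.
move=> y x z hxy /subgroupV hyz.
by rewrite /lcoset_rel; have := subgroupF hxy hyz; rewrite invgK mulgA mulgK.
Qed.

Canonical lcoset_equiv : equiv_rel G :=
  EquivRel lcoset_rel lcoset_refl lcoset_sym lcoset_trans.

Definition coset_space : Type := quotient_topology {eq_quot lcoset_equiv}.

HB.instance Definition _ := Topological.on coset_space.
HB.instance Definition _ := Quotient.on coset_space.
HB.instance Definition _ := isPointed.Build coset_space (\pi_coset_space 1%g).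

Definition coset_proj (x : G) : coset_space := \pi_coset_space x.

(* The map x H |-> f(x) H; the choice of representative is immaterial as soon
   as f respects left cosets of H (see coset_mapE). *)
Definition coset_map (f : G -> G) (q : coset_space) : coset_space :=
  coset_proj (f (repr q)).

Lemma coset_projP x y :
  coset_proj x = coset_proj y <-> (x^-1 * y)%g \in (H : set G).
Proof. by split => [/eqmodP | h]; [|exact/eqmodP]. Qed.

Lemma coset_mapE (f : G -> G) :
  (forall x y, lcoset_rel x y -> lcoset_rel (f x) (f y)) ->
  forall x, coset_map f (coset_proj x) = coset_proj (f x).
Proof. by move=> fH x; apply/coset_projP/fH/coset_projP; exact: reprK. Qed.

Lemma coset_map_morphE (phi : UMagmaMorphism.type G G) : phi @` H `<=` H ->
  forall x, coset_map phi (coset_proj x) = coset_proj (phi x).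
Proof.
move=> phiH; apply: coset_mapE => x y /set_mem hxy; apply/mem_set.
by rewrite -gmulfV -gmulfM; apply: phiH; exists (x^-1 * y)%g.
Qed.

Definition coset_translation (g : G) : coset_space -> coset_space :=
  coset_map (fun x => (g * x)%g).

Lemma coset_translationE (g x : G) :
  coset_translation g (coset_proj x) = coset_proj (g * x)%g.
Proof.
by apply: coset_mapE => {}x y; rewrite /lcoset_rel invgM mulgA mulgVK.
Qed.

End coset_space.

Section scale_nub.
Variable G : topologicalGroupType.

Definition compact_open_subgroup (U : set G) : Prop :=
  [/\ is_subgroup U, compact U & open U].

Definition lcosets (A B : set G) : set (set G) :=
  [set [set (x * b)%g | b in B] | x in A].

(* Junk value 0 if there are infinitely many cosets; this does not happen for
   [phi U : U & phi U] when U is compact open and phi is continuous. *)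
Definition sgindex (A B : set G) : nat := #|` fset_set (lcosets A B)|%N.

Variable phi : G -> G.

Definition displacement (U : set G) : nat :=
  sgindex (phi @` U) (U `&` phi @` U).

Definition scale : nat :=
  xget 0%N [set n : nat |
    (exists2 U, compact_open_subgroup U & displacement U = n) /\
    (forall V, compact_open_subgroup V -> (n <= displacement V)%N)].

(* The default value of xget is never used: a totally disconnected locally
   compact group has a compact open subgroup. *)
Lemma scale_attained (U : set G) : compact_open_subgroup U ->
  exists2 V : set G, compact_open_subgroup V & displacement V = scale.
Proof.
move=> cU; rewrite /scale.
case: xgetP => [n _ [[V cV <-] _]|]; first by exists V.
pose P n :=
  `[< exists2 V : set G, compact_open_subgroup V & displacement V = n >].
have exP : exists n, P n by exists (displacement U); apply/asboolP; exists U.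
case: (ex_minnP exP) => m /asboolP hm mm /(_ m) []; split => // V cV.
by apply: mm; apply/asboolP; exists V.
Qed.

Definition minimizing (U : set G) : Prop :=
  compact_open_subgroup U /\ scale = displacement U.

Definition nub : set G := \bigcap_(U in minimizing) U.

Lemma nub_is_subgroup : is_subgroup nub.
Proof.
split; first by apply/mem_set => U [[[/set_mem U1 _] _ _] _].
move=> x y /set_mem nx /set_mem ny; apply/mem_set => U mU.
have [[[_ UF] _ _] _] := mU.
by apply/set_mem/UF; apply/mem_set; [exact: nx | exact: ny].
Qed.

Definition nub_subgroup : subgroup G := Subgroup nub_is_subgroup.

End scale_nub.

Section entropy.
Variables (R : realType) (G : topologicalGroupType) (H : subgroup G).

Definition borel_coset_space : Type :=
  g_sigma_algebraType (@open (coset_space H)).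

HB.instance Definition _ := Measurable.on borel_coset_space.

Definition invariant_coset_measure
    (mu : {measure set borel_coset_space -> \bar R}) : Prop :=
  [/\ forall (g : G) (A : set borel_coset_space), measurable A ->
        mu (coset_translation g @` A) = mu A,
      forall C : set (coset_space H), compact C -> (mu C < +oo)%E &
      exists2 C : set (coset_space H), compact C & (0 < mu C)%E].

Variables (mu : {measure set borel_coset_space -> \bar R})
  (f : coset_space H -> coset_space H).

Definition cotrajectory (A : set (coset_space H)) (n : nat) :
    set (coset_space H) :=
  \bigcap_(i in `I_n.+1) (iter i f @^-1` A).

Definition entropy_at (A : set (coset_space H)) : \bar R :=
  limn_esup (fun n => - ((n%:R^-1)%:E * lne (mu (cotrajectory A n))))%E.

Definition topological_entropy : \bar R :=
  ereal_sup [set entropy_at (@coset_proj G H @` K) |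
             K in [set K | compact_open_subgroup K /\ H `<=` K]].

End entropy.

(* Main.v *)
(* Write U_{-n} for the subgroup of x with phi^i(x) in U for all i <= n, and s
   for the scale.  Since phi induces injections U_{-n-1}/U_{-n-2} ->
   U_{-n}/U_{-n-1}, the indices [U_{-n} : U_{-n-1}] decrease, and each of them is
   the displacement of U_{-n}, hence at least s.  So [K : K_{-n}] >= s^n for every
   compact open subgroup K, with equality if K is minimizing; moreover U_{-1} is
   minimizing when U is, so that phi(nub) <= nub.

   The upper bound [K : K_{-n}] <= C s^n for K >= nub follows by compactness once
   two minimizing subgroups are known to contain a third one in their
   intersection.  For this, the growth of [U : U /\ phi^-n U], which does not
   depend on U up to a constant, is bounded below by s^n: let L be the group of
   the x which have a backward trajectory ending in U and a forward trajectory
   ending in U.  It is relatively compact, so U contains an open subgroup U'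
   normalized by L, and V = U' L is compact and open.  A compact open W <= U' of
   least displacement satisfies W = W_+ W_-, whence W /\ phi^-n W <= L W_{-n} <=
   V_{-n} and s^n <= [V : V_{-n}] <= [V : W]^2 [V : V /\ phi^-n V].

   Finally the measure of the image of K_{-n} in G/nub is that of the image of K
   divided by [K : K_{-n}]. *)
From HB Require Import structures.
Require Import Defs.
From mathcomp Require Import all_boot all_order all_algebra.
From mathcomp Require Import generic_quotient finmap.
From mathcomp Require Import all_classical all_reals all_analysis.
From mathcomp Require Import zify.

Set Implicit Arguments.
Unset Strict Implicit.
Unset Printing Implicit Defensive.

Import Order.TTheory GRing.Theory Num.Theory.
Import numFieldNormedType.Exports.

Local Open Scope classical_set_scope.

(** * Compactness, cosets and indices *)

(** Near-covering compactness for the filter generated by the sections of [D]: each point of [K] has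
    a neighbourhood missed by all small enough members of [D]. *)
Lemma compact_directed (T : topologicalType) (K : set T) (D : set (set T)) :
  compact K -> D !=set0 -> (forall A, D A -> closed A) ->
  (forall A B, D A -> D B -> exists2 C, D C & C `<=` A `&` B) ->
  K `&` \bigcap_(A in D) A = set0 -> exists2 A, D A & K `&` A = set0.
Proof.
move=> /compact_near_coveringP cK [A0 DA0] Dcl Ddir KD.
pose F := filter_from D (fun A => [set B | D B /\ B `<=` A]).
have FF : Filter F.
  apply: filter_from_filter; first by exists A0.
  move=> A B DA DB; have [C DC CAB] := Ddir _ _ DA DB.
  by exists C => // E [DE EC]; split; split => // x /EC /CAB[].
have : F [set A | K `<=` [set x | ~ A x]].
  apply: (cK _ F (fun A x => ~ A x) FF) => x Kx.
  have [A DA nAx] : exists2 A, D A & ~ A x.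
    apply: contrapT => /forall2NP h.
    suff : (K `&` \bigcap_(A in D) A) x by rewrite KD.
    by split=> // B DB; have [|/contrapT] := h B.
  exists (~` A, [set B | D B /\ B `<=` A]) => /=.
    split; last by exists A.
    by apply: open_nbhs_nbhs; split=> //; rewrite openC; exact: Dcl.
  by case=> y B /= [nAy [_ BA]] /BA.
move=> [A DA /(_ A) KA]; exists A => //.
apply/seteqP; split=> // x [Kx Ax].
by have /= := KA (conj DA (fun=> id)) x Kx; apply.
Qed.

(** The traces of the fibre of [y] on the [A n] are compact, decreasing and nonempty. This limit
    argument yields infinite backward trajectories and, for multiplication on a product, the
    factorization of tidy subgroups. *)
Lemma image_bigcap_compact (T S : topologicalType) (f : T -> S)
    (A : nat -> set T) (y : S) :
  hausdorff_space T -> hausdorff_space S -> continuous f ->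
  (forall n, compact (A n)) -> (forall n, A n.+1 `<=` A n) ->
  (forall n, (f @` A n) y) -> (f @` (\bigcap_n A n)) y.
Proof.
move=> hT hS cf cA dA Ay.
have leA m n : (m <= n)%N -> A n `<=` A m.
  move=> /subnK <-; elim: (n - m)%N => // k IH.
  by rewrite addSn; apply: subset_trans (dA _) IH.
apply: contrapT => nAy.
have cy : closed (f @^-1` [set y]).
  apply: closed_comp; first by move=> *; exact: cf.
  exact/accessible_closed_set1/hausdorff_accessible.
have [|||||_ [n _ <-]] :=
    @compact_directed T (f @^-1` [set y] `&` A 0%N) (range A).
- by rewrite setIC; exact: compact_closedI.
- by exists (A 0%N), 0%N.
- by move=> _ [n _ <-]; exact: compact_closed.
- move=> _ _ [n _ <-] [m _ <-]; exists (A (maxn n m));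
    first by exists (maxn n m).
  by move=> x Ax; split; apply: leA Ax; rewrite ?leq_maxl ?leq_maxr.
- apply/seteqP; split=> // x [[fxy _] Ax]; apply: nAy; exists x => // n _.
  by apply: Ax; exists n.
move=> /seteqP[/(_ _) h _]; have [x Ax fxy] := Ay n.
by apply: (h x); split => //; split=> //; exact: (leA 0%N n).
Qed.

Section groups.
Variable G : topologicalGroupType.
Implicit Types (A B C H K U V : set G) (x y z : G).
Local Open Scope group_scope.

Lemma is_subgroupP H :
  is_subgroup H <-> H 1 /\ forall x y, H x -> H y -> H (x / y).
Proof.
split=> [[/set_mem H1 HF]|[H1 HF]].
  by split=> // x y Hx Hy; apply/set_mem/HF; exact/mem_set.
split; first exact/mem_set.
by move=> x y /set_mem Hx /set_mem Hy; exact/mem_set/HF.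
Qed.

Section subgroup.
Variable H : set G.
Hypothesis sH : is_subgroup H.

Lemma sub1g : H 1. Proof. by have /is_subgroupP[] := sH. Qed.

Lemma subFg x y : H x -> H y -> H (x / y).
Proof. by have /is_subgroupP[_] := sH; apply. Qed.

Lemma subVg x : H x -> H x^-1.
Proof. by move=> Hx; rewrite -div1g; apply: subFg => //; exact: sub1g. Qed.

Lemma subMg x y : H x -> H y -> H (x * y).
Proof. by move=> Hx Hy; rewrite -[y]invgK; apply: subFg => //;
  exact: subVg. Qed.

Lemma subVMg x y : H x -> H y -> H (x^-1 * y).
Proof. by move=> Hx Hy; apply: subMg => //; exact: subVg. Qed.

End subgroup.

Lemma is_subgroupI H K : is_subgroup H -> is_subgroup K ->
  is_subgroup (H `&` K).
Proof.
move=> sH sK; apply/is_subgroupP; split; first by split; exact: sub1g.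
by move=> x y [? ?] [? ?]; split; exact: subFg.
Qed.

Lemma is_subgroup_preimage (f : UMagmaMorphism.type G G) H :
  is_subgroup H -> is_subgroup (f @^-1` H).
Proof.
move=> sH; apply/is_subgroupP; split; first by rewrite /= gmulf1; exact: sub1g.
by move=> x y /= Hx Hy; rewrite gmulfF; exact: subFg.
Qed.

Lemma is_subgroup_image (f : UMagmaMorphism.type G G) H :
  is_subgroup H -> is_subgroup (f @` H).
Proof.
move=> sH; apply/is_subgroupP; split; first by exists 1; rewrite ?gmulf1 //;
  exact: sub1g.
move=> _ _ [x Hx <-] [y Hy <-]; exists (x / y); last by rewrite gmulfF.
exact: subFg.
Qed.

Lemma mull_continuous x : continuous (fun y => x * y).
Proof.
move=> y;
  apply: (@continuous2_cvg _ _ _ _ _ _ (fun=> x) id (fun a b : G => a * b) x y).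
- exact: (@mulg_continuous G (x, y)).
- exact: cvg_cst.
- exact: cvg_id.
Qed.

Lemma open_lcoset U x : open U -> open [set y | U (x * y)].
Proof. by move=> oU; apply: open_comp => // y _; exact: mull_continuous. Qed.

Lemma is_subgroup_open H : is_subgroup H -> nbhs 1 H -> open H.
Proof.
move=> sH; rewrite nbhsE => -[U [oU U1] UH].
rewrite openE => x Hx; rewrite /interior nbhsE.
exists [set y | U (x^-1 * y)].
  by split; [exact: open_lcoset|rewrite /= mulVg].
by move=> y /= /UH Hxy; rewrite -(mulVKg x y); exact: subMg.
Qed.

Lemma is_subgroup_closed H : is_subgroup H -> open H -> closed H.
Proof.
move=> sH oH; rewrite -[H]setCK; apply: open_closedC.
rewrite openE => x nHx; rewrite /interior nbhsE.
exists [set y | H (x^-1 * y)].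
  by split; [exact: open_lcoset|rewrite /= mulVg; exact: sub1g].
move=> y /= Hxy Hy; apply: nHx; rewrite -[x]invgK; apply: subVg => //.
by rewrite -(mulgK y x^-1); exact: subFg.
Qed.

Lemma compact_translates K U : compact K -> open U -> U 1 ->
  exists s : seq G, forall k, K k -> exists2 x, x \in s & U (x^-1 * k).
Proof.
move=> /compact_near_coveringP cK oU U1.
pose F := filter_from setT (fun s : seq G => [set t : seq G | {subset s <= t}]).
have FF : Filter F.
  apply: filter_from_filter; first by exists [::].
  move=> s t _ _; exists (s ++ t) => // r h.
  by split=> x xs; apply: h; rewrite mem_cat xs ?orbT.
have : F [set s | K `<=` [set k | exists2 x, x \in s & U (x^-1 * k)]].
  apply: (cK _ F (fun s k => exists2 x, x \in s & U (x^-1 * k)) FF) => x Kx.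
  exists ([set y | U (x^-1 * y)], [set t | {subset [:: x] <= t}]).
    split; last by exists [:: x].
    by apply: open_nbhs_nbhs; split; [exact: open_lcoset|rewrite /= mulVg].
  by case=> y t /= [Uy xt]; exists x => //; apply: xt; rewrite mem_head.
by move=> [s _ /(_ s (fun _ => id)) h]; exists s => k /h.
Qed.

(* [A : A `&` B]; junk value 0 if this is infinite *)
Definition relindex A B : nat := sgindex A (A `&` B).

(** [B] need not lie in [A]: these represent [A] modulo the intersection with [B]. When [A] is a
    subgroup, the quotients tested are already in [A], so membership in [B] decides. *)
Definition transversal (I : finType) A B (f : I -> G) :=
  [/\ forall i, A (f i), forall i j, B ((f i)^-1 * f j) -> i = j &
      forall a, A a -> exists i, B ((f i)^-1 * a)].

Definition finite_index A B := exists (I : finType) (f : I -> G),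
  transversal A B f.

Lemma lcosetP A B x y : is_subgroup A -> is_subgroup B -> A x -> A y ->
  [set x * b | b in A `&` B] = [set y * b | b in A `&` B] <-> B (x^-1 * y).
Proof.
move=> sA sB Ax Ay; have sAB := is_subgroupI sA sB; split=> [e|Bxy].
  have : [set y * b | b in A `&` B] y by exists 1; rewrite ?mulg1 //;
    exact: sub1g.
  by rewrite -e => -[b [_ Bb] <-]; rewrite mulKg.
have ABxy : (A `&` B) (x^-1 * y) by split=> //; exact: subVMg.
apply/seteqP; split=> _ [b ABb <-].
  exists ((x^-1 * y)^-1 * b); first exact: subVMg.
  by rewrite invgM invgK !mulgA mulgV mul1g.
by exists (x^-1 * y * b); [exact: subMg|rewrite !mulgA mulgV mul1g].
Qed.

Lemma relindexE (I : finType) A B (f : I -> G) : is_subgroup A ->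
  is_subgroup B ->
  transversal A B f -> relindex A B = #|I|.
Proof.
move=> sA sB [Af fi fs]; rewrite /relindex /sgindex.
pose g i := [set f i * b | b in A `&` B].
have -> : lcosets A (A `&` B) = g @` setT.
  apply/seteqP; split=> [_ [a Aa <-]|_ [i _ <-]]; last by exists (f i).
  by have [i Bi] := fs a Aa; exists i => //; exact/lcosetP.
have gi : injective g by move=> i j /lcosetP Bfij; apply: fi; exact: Bfij.
rewrite (_ : g @` setT = [set` [fset g i | i in I]%fset]).
  by rewrite set_fsetK card_imfset //= -cardE.
apply/seteqP; split=> [_ [i _ <-]|_ /= /imfsetP[i _ ->]]; last by exists i.
by apply/imfsetP; exists i.
Qed.

(** Stated for a subgroup merely contained in a compact set, so as to cover the image under [phi] of
    the group [loops0]. *)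
Lemma finite_index_compact K A B : compact K -> A `<=` K -> is_subgroup A ->
  is_subgroup B -> open B -> finite_index A B.
Proof.
move=> cK AK sA sB oB; have sAB := is_subgroupI sA sB.
have [s sP] := compact_translates cK oB (sub1g sB).
(* The points of [s] may lie outside [A], but each coset is the trace on [A] of some x B with x in
   [s]. Representatives inside [A] are chosen afterwards. *)
have fin : finite_set (lcosets A (A `&` B)).
  apply: (@sub_finite_set _ _
    ((fun x => A `&` [set y | B (x^-1 * y)]) @` [set` s])); last first.
    exact/finite_image/finite_seq.
  move=> _ [a Aa <-]; have [x xs Bx] := sP _ (AK _ Aa); exists x => //.
  apply/seteqP; split=> [y [Ay /= By]|_ [b [Ab Bb] <-]].
    exists (a^-1 * y); last by rewrite mulVKg.
    split; first exact: subVMg.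
    have -> : a^-1 * y = (x^-1 * a)^-1 * (x^-1 * y).
      by rewrite invgM invgK mulgA mulgK.
    exact: subVMg.
  by split; [exact: subMg|rewrite /= mulgA; exact: subMg].
have P (d : fset_set (lcosets A (A `&` B))) :
    exists2 x, A x & val d = [set x * b | b in A `&` B].
  by have := valP d; rewrite in_fset_set // => /set_mem[x Ax <-]; exists x.
exists (fset_set (lcosets A (A `&` B))), (fun d => sval (cid2 (P d))).
split=> [d|d e|a Aa]; first by case: cid2.
  case: cid2 => x Ax dE; case: cid2 => y Ay eE /= /lcosetP h.
  by apply: val_inj; rewrite dE eE; apply: h.
have da : [set a * b | b in A `&` B] \in fset_set (lcosets A (A `&` B)).
  by rewrite in_fset_set //; apply/mem_set; exists a.
exists [` da]%fset; case: cid2 => x Ax /= e.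
by apply/(lcosetP sA sB) => //; rewrite -e.
Qed.

Lemma relindex_gt0 A B : is_subgroup A -> is_subgroup B -> finite_index A B ->
  (0 < relindex A B)%N.
Proof.
move=> sA sB [I [f tf]]; rewrite (relindexE sA sB tf); case: tf => _ _ fs.
by have [i _] := fs _ (sub1g sA); apply/card_gt0P; exists i.
Qed.

(* The relation [R] only has to induce an injection [A / B -> A' / B']. *)
Lemma relindex_inj_rel A B A' B' (R : G -> G -> Prop) :
  is_subgroup A -> is_subgroup B -> is_subgroup A' -> is_subgroup B' ->
  finite_index A B -> finite_index A' B' ->
  (forall a, A a -> exists2 a', A' a' & R a a') ->
  (forall a b a' b', A a -> A b -> A' a' -> A' b' -> R a a' -> R b b' ->
     B' (a'^-1 * b') -> B (a^-1 * b)) ->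
  (relindex A B <= relindex A' B')%N /\
  (relindex A B = relindex A' B' ->
    forall y, A' y -> exists a a', [/\ A a, A' a', R a a' & B' (a'^-1 * y)]).
Proof.
move=> sA sB sA' sB' [I [f tf]] [I' [f' tf']] RA RB.
rewrite (relindexE sA sB tf) (relindexE sA' sB' tf').
case: tf tf' => [Af fi fs] [Af' fi' fs'].
have P i : exists j, exists a', [/\ A' a', R (f i) a' & B' ((f' j)^-1 * a')].
  by have [a' Aa' Ra'] := RA _ (Af i); have [j Bj] := fs' _ Aa'; exists j, a'.
have [g gP] := choice P.
have gi : injective g.
  move=> i j gij; have [a [Aa Ra Ba]] := gP i; have [b [Ab Rb Bb]] := gP j.
  apply: fi; apply: (RB _ _ a b) => //.
  have -> : a^-1 * b = ((f' (g i))^-1 * a)^-1 * ((f' (g i))^-1 * b).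
    by rewrite invgM invgK mulgA mulgK.
  by apply: subVMg => //; rewrite gij.
split; first by rewrite -(card_codom gi); exact: max_card.
move=> e y Ay; have [h gh hg] : bijective g by apply: inj_card_bij; rewrite ?e.
have [j Bj] := fs' _ Ay; have [a [Aa Ra Ba]] := gP (h j).
exists (f (h j)), a; split=> //.
have -> : a^-1 * y = ((f' (g (h j)))^-1 * a)^-1 * ((f' (g (h j)))^-1 * y).
  by rewrite invgM invgK mulgA mulgK.
by apply: subVMg => //; rewrite hg.
Qed.

Lemma relindex_mul A B C : is_subgroup A -> is_subgroup B -> is_subgroup C ->
  finite_index A B -> finite_index (A `&` B) C ->
  relindex A (B `&` C) = (relindex A B * relindex (A `&` B) C)%N.
Proof.
move=> sA sB sC [I [f tf]] [J [g tg]]; have sAB := is_subgroupI sA sB.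
rewrite (relindexE sA sB tf) (relindexE sAB sC tg).
have -> : (#|I| * #|J| = #|{: I * J}|)%N by rewrite card_prod.
case: tf tg => [Af fi fs] [Bg gi gs].
apply: (@relindexE _ _ _ (fun ij => f ij.1 * g ij.2)) => //.
  exact: is_subgroupI.
split=> [[i j]|[i j] [k l] /=|a Aa] /=.
- by apply: subMg => //; have [] := Bg j.
- rewrite invgM => -[Bfij Cij].
  have ik : i = k.
    apply: fi; have -> : (f i)^-1 * f k =
        g j * ((g j)^-1 * (f i)^-1 * (f k * g l)) * (g l)^-1.
      by rewrite !mulgA mulgV mul1g mulgK.
    by apply: subFg => //; [apply: subMg => //; have [] := Bg j|have [] :=
      Bg l].
  congr pair => //; apply: gi; move: Cij.
  by rewrite ik mulgA mulgVK.
- have [i Bi] := fs _ Aa.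
  have [|j Cj] := gs ((f i)^-1 * a); first by split=> //; exact: subVMg.
  exists (i, j) => /=; rewrite invgM -mulgA; split=> //.
  by apply: subVMg => //; have [] := Bg j.
Qed.

End groups.

(** * Trajectories and displacements *)

Lemma iter_is_monoid_morphism (G : topologicalGroupType)
  (phi : UMagmaMorphism.type G G) n :
  iter n phi 1%g = 1%g /\ {morph iter n phi : x y / (x * y)%g}.
Proof.
elim: n => [|n [IH1 IHM]]; first by split.
by split=> [|x y] /=; rewrite ?IH1 ?IHM ?gmulf1 ?gmulfM.
Qed.

HB.instance Definition _ (G : topologicalGroupType)
    (phi : UMagmaMorphism.type G G) n :=
  isUMagmaMorphism.Build G G (iter n phi) (iter_is_monoid_morphism phi n).

Section dynamics.
Variables (G : topologicalGroupType) (phi : UMagmaMorphism.type G G).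
Hypothesis cphi : continuous phi.
Implicit Types (A B C H K U V W : set G) (x y z : G).
Local Open Scope group_scope.
Local Notation cosg := (@compact_open_subgroup G).

Lemma iter_continuous n : continuous (iter n phi).
Proof.
elim: n => [|n IH] x; first exact: cvg_id.
by apply: (@continuous_comp _ _ _ (iter n phi) phi); [exact: IH|exact: cphi].
Qed.

Lemma itergM n x y : iter n phi (x * y) = iter n phi x * iter n phi y.
Proof. exact: gmulfM. Qed.

Lemma itergV n x : iter n phi x^-1 = (iter n phi x)^-1.
Proof. exact: gmulfV. Qed.

Lemma itergF n x y : iter n phi (x / y) = iter n phi x / iter n phi y.
Proof. exact: gmulfF. Qed.

Lemma open_iter_preimage n U : open U -> open (iter n phi @^-1` U).
Proof. by apply: open_comp => x _; exact: iter_continuous. Qed.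

Lemma cosg_sub V H : cosg V -> is_subgroup H -> open H -> H `<=` V -> cosg H.
Proof.
move=> [sV cV oV] sH oH HV; split=> //.
apply: subclosed_compact cV HV; exact: is_subgroup_closed.
Qed.

Lemma cosgI V H : cosg V -> is_subgroup H -> open H -> cosg (V `&` H).
Proof.
move=> cV sH oH; have [sV _ oV] := cV.
apply: (cosg_sub cV); [exact: is_subgroupI|exact: openI|exact: subIsetl].
Qed.

Lemma cosg_finite_index U H : cosg U -> is_subgroup H -> open H ->
  finite_index U H.
Proof. by move=> [sU cU _] sH oH; exact: (finite_index_compact cU). Qed.

Lemma cosg_image_finite_index U H : cosg U -> is_subgroup H -> open H ->
  finite_index (phi @` U) H.
Proof.
move=> [sU cU _] sH oH; have := is_subgroup_image phi sU.
have cU' : compact (phi @` U).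
  by apply: continuous_compact => //; exact: continuous_subspaceT.
by move=> sU'; exact: (finite_index_compact cU').
Qed.

Lemma relindex_inj A B A' B' (f : G -> G) : cosg A -> cosg A' ->
  is_subgroup B -> is_subgroup B' -> open B -> open B' ->
  (forall a, A a -> A' (f a)) ->
  (forall a b, A a -> A b -> B' ((f a)^-1 * f b) -> B (a^-1 * b)) ->
  (relindex A B <= relindex A' B')%N /\
  (relindex A B = relindex A' B' ->
    forall y, A' y -> exists2 a, A a & B' ((f a)^-1 * y)).
Proof.
move=> cA cA' sB sB' oB oB' fA fB.
have [sA _ _] := cA; have [sA' _ _] := cA'.
have [||||] :=
  @relindex_inj_rel G A B A' B' (fun a a' => a' = f a) sA sB sA' sB'.
- exact: cosg_finite_index.
- exact: cosg_finite_index.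
- by move=> a Aa; exists (f a) => //; exact: fA.
- by move=> a b _ _ Aa Ab _ _ -> ->; exact: fB.
- by move=> le eq; split=> // /eq h y /h[a [_ [Aa _ -> ?]]]; exists a.
Qed.

Lemma relindexM A B C : cosg A -> is_subgroup B -> open B ->
  is_subgroup C -> open C ->
  relindex A (B `&` C) = (relindex A B * relindex (A `&` B) C)%N.
Proof.
move=> cA sB oB sC oC; have [sA _ _] := cA.
apply: relindex_mul => //; apply: cosg_finite_index => //; exact: cosgI.
Qed.

Definition cotraj K n : set G := \bigcap_(i in `I_n.+1) (iter i phi @^-1` K).

Lemma cotrajP K n x : cotraj K n x <-> forall i, (i <= n)%N -> K (iter i phi x).
Proof. by []. Qed.

Lemma cotraj_sub K n : cotraj K n `<=` K.
Proof. by move=> x /cotrajP/(_ 0%N); exact. Qed.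

Lemma cotraj0 K : cotraj K 0 = K.
Proof.
apply/seteqP; split; first exact: cotraj_sub.
by move=> x Kx; apply/cotrajP => -[].
Qed.

Lemma cotraj_le K n m : (m <= n)%N -> cotraj K n `<=` cotraj K m.
Proof. by move=> mn x Kx i im; apply: Kx; exact: leq_trans mn. Qed.

Lemma cotrajD K n m x :
  cotraj K n x -> cotraj K m (iter n phi x) -> cotraj K (n + m) x.
Proof.
move=> Kx Ky i; rewrite /= ltnS => inm; have [ni|/ltnW ni] := leqP n i.
  rewrite -(subnK ni) iterD; apply: Ky.
  by rewrite /= ltnS leq_subLR.
exact: Kx.
Qed.

Lemma cotraj_iter K n m x : cotraj K (n + m) x -> cotraj K m (iter n phi x).
Proof.
move=> Kx i im; rewrite /= -iterD; apply: Kx.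
by rewrite /= ltnS addnC leq_add2l.
Qed.

Lemma cotrajS K n : cotraj K n.+1 = cotraj K n `&` iter n.+1 phi @^-1` K.
Proof.
apply/seteqP; split=> x.
  by move=> Kx; split; [exact: cotraj_le Kx|exact: (Kx n.+1 (ltnSn _))].
move=> [Kx Ky]; rewrite -addn1; apply: cotrajD => //.
apply/cotrajP => -[|[|//]] _ //=.
by exact: (Kx n (ltnSn _)).
Qed.

Lemma cotraj_subgroup K n : is_subgroup K -> is_subgroup (cotraj K n).
Proof.
move=> sK; apply/is_subgroupP; split; first by move=> i _; rewrite /= gmulf1;
  exact: sub1g.
by move=> x y Kx Ky i ni; rewrite /= gmulfF; apply: subFg => //;
  [exact: Kx|exact: Ky].
Qed.

Lemma cotraj_open K n : open K -> open (cotraj K n).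
Proof.
move=> oK; elim: n => [|n IH]; first by rewrite cotraj0.
by rewrite cotrajS; apply: openI => //; exact: open_iter_preimage.
Qed.

Lemma cosg_cotraj K n : cosg K -> cosg (cotraj K n).
Proof.
move=> cK; have [sK _ oK] := cK; apply: (cosg_sub cK).
- exact: cotraj_subgroup.
- exact: cotraj_open.
- exact: cotraj_sub.
Qed.

(** phi induces a bijection from K_{-n} / K_{-n-1} onto the cosets counted by the displacement: for
    x in K_{-n}, phi(x) lies in K_{-n} exactly when phi^(n+1)(x) lies in K. The graph of phi, read
    in both directions, gives the two inequalities. *)
Lemma displacement_cotraj K n : cosg K ->
  displacement phi (cotraj K n) = relindex (cotraj K n) (iter n.+1 phi @^-1` K).
Proof.
move=> cK; have [sK _ oK] := cK; have cA := cosg_cotraj n cK.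
have [sA _ oA] := cA.
have sA' := is_subgroup_image phi sA.
have sB : is_subgroup (iter n.+1 phi @^-1` K) by exact: is_subgroup_preimage.
have oB := open_iter_preimage n.+1 oK.
rewrite /displacement setIC -/(relindex _ _).
have K1 x : cotraj K n x -> K (iter n.+1 phi x) -> cotraj K n (phi x).
  by move=> Kx Ky; apply: (@cotraj_iter K 1%N); rewrite add1n cotrajS.
apply/eqP; rewrite eqn_leq; apply/andP; split.
- have [||||//] := @relindex_inj_rel G (phi @` cotraj K n) (cotraj K n)
    (cotraj K n) (iter n.+1 phi @^-1` K) (fun a b => phi b = a) sA' sA sA sB.
  + exact: cosg_image_finite_index.
  + exact: cosg_finite_index.
  + by move=> _ [x Kx <-]; exists x.
  + move=> _ _ a b _ _ Ka Kb <- <- /= Kab.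
    by rewrite -gmulfV -gmulfM; apply: K1 => //; exact: (subVMg sA).
- have [||||//] := @relindex_inj_rel G (cotraj K n) (iter n.+1 phi @^-1` K)
    (phi @` cotraj K n) (cotraj K n) (fun a b => b = phi a) sA sB sA' sA.
  + exact: cosg_finite_index.
  + exact: cosg_image_finite_index.
  + by move=> x Kx; exists (phi x) => //; exists x.
  + move=> a b _ _ Ka Kb _ _ -> -> /=.
    by rewrite -gmulfV -gmulfM => /(_ n); rewrite /= -iterSr; exact.
Qed.

Lemma relindex_cotrajS K n : cosg K ->
  relindex K (cotraj K n.+1) =
  (relindex K (cotraj K n) * displacement phi (cotraj K n))%N.
Proof.
move=> cK; have [sK _ oK] := cK;
  rewrite displacement_cotraj // cotrajS relindexM //.
- by rewrite (setIidr (@cotraj_sub K n)).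
- exact: cotraj_subgroup.
- exact: cotraj_open.
- exact: is_subgroup_preimage.
- exact: open_iter_preimage.
Qed.

(** Through [displacement_cotraj] this compares successive indices, and phi is the injection: the
    (n+2)-nd iterate of x is the (n+1)-st iterate of phi(x). *)
Lemma displacement_cotraj_ge K n m : cosg K -> (n <= m)%N ->
  (displacement phi (cotraj K m) <= displacement phi (cotraj K n))%N.
Proof.
move=> cK /subnK <-; elim: (m - n)%N => // k; apply: leq_trans.
rewrite addSn; move: {n m k}(k + n)%N => n.
have [sK _ oK] := cK; rewrite !displacement_cotraj //.
have [||||||||//] := @relindex_inj (cotraj K n.+1) (iter n.+2 phi @^-1` K)
    (cotraj K n) (iter n.+1 phi @^-1` K) phi.
- exact: cosg_cotraj.
- exact: cosg_cotraj.
- exact: is_subgroup_preimage.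
- exact: is_subgroup_preimage.
- exact: open_iter_preimage.
- exact: open_iter_preimage.
- by move=> a; exact: (@cotraj_iter K 1%N).
- by move=> a b _ _; rewrite -gmulfV -gmulfM /= -iterSr.
Qed.

Lemma displacement_gt0 V : cosg V -> (0 < displacement phi V)%N.
Proof.
move=> cV; have [sV _ oV] := cV; have sV' := is_subgroup_image phi sV.
rewrite /displacement setIC -/(relindex _ _); apply: relindex_gt0 => //.
exact: cosg_image_finite_index.
Qed.

Lemma scale_le V : cosg V -> (scale phi <= displacement phi V)%N.
Proof.
(* With the default value 0 of [xget] the bound is trivial. *)
move=> cV; rewrite /scale; case: xgetP => [n _ [_ h]|//].
exact: h.
Qed.

Lemma expn_scale_le K n : cosg K ->
  (scale phi ^ n <= relindex K (cotraj K n))%N.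
Proof.
move=> cK; have [sK _ oK] := cK; elim: n => [|n IH].
  rewrite expn0; apply: relindex_gt0 => //; first exact: cotraj_subgroup.
  by apply: cosg_finite_index => //;
    [exact: cotraj_subgroup|exact: cotraj_open].
rewrite expnS mulnC relindex_cotrajS //; apply: leq_mul => //.
exact/scale_le/cosg_cotraj.
Qed.

Lemma relindex_cotraj_const K n : cosg K ->
  (forall m, displacement phi (cotraj K m) = displacement phi K) ->
  relindex K (cotraj K n) = (displacement phi K ^ n)%N.
Proof.
move=> cK h; have [sK _ _] := cK; elim: n => [|n IH].
  rewrite cotraj0 expn0 (@relindexE _ unit _ _ (fun=> 1)) ?card_unit //.
  split=> [_|[] []//|a Ka]; first exact: sub1g.
  by exists tt; rewrite invg1 mul1g.
by rewrite relindex_cotrajS // IH h expnSr.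
Qed.

Lemma minimizing_cotraj U n : minimizing phi U -> minimizing phi (cotraj U n).
Proof.
move=> [cU sU]; have cUn := cosg_cotraj n cU; split=> //.
apply/eqP; rewrite eqn_leq scale_le //= sU -{2}(cotraj0 U).
exact: displacement_cotraj_ge.
Qed.

Lemma relindex_cotraj_minimizing U n : minimizing phi U ->
  relindex U (cotraj U n) = (scale phi ^ n)%N.
Proof.
move=> mU; have [cU ->] := mU; apply: relindex_cotraj_const => // m.
by have [_ <-] := minimizing_cotraj m mU; case: mU.
Qed.

Lemma nub_invariant : phi @` nub phi `<=` nub phi.
Proof.
move=> _ [x nx <-] U mU; have := nx _ (minimizing_cotraj 1%N mU).
by move=> /cotrajP/(_ 1%N); exact.
Qed.

End dynamics.

(** * Loops and tidying *)

Lemma hausdorff_prod (T S : topologicalType) :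
  hausdorff_space T -> hausdorff_space S -> hausdorff_space (T * S)%type.
Proof.
move=> hT hS [p q] [p' q'] cl; congr pair.
  apply: hT => A B nA nB; have [] := cl (fst @^-1` A) (fst @^-1` B).
  - by exists (A, setT) => [|[x y] []//]; split=> //; exact: filterT.
  - by exists (B, setT) => [|[x y] []//]; split=> //; exact: filterT.
  - by move=> [x y] [? ?]; exists x.
apply: hS => A B nA nB; have [] := cl (snd @^-1` A) (snd @^-1` B).
- by exists (setT, A) => [|[x y] []//]; split=> //; exact: filterT.
- by exists (setT, B) => [|[x y] []//]; split=> //; exact: filterT.
- by move=> [x y] [? ?]; exists y.
Qed.

Lemma fst_continuous (T S : topologicalType) : continuous (@fst T S).
Proof. by move=> [x y]; exact: cvg_fst. Qed.

Lemma snd_continuous (T S : topologicalType) : continuous (@snd T S).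
Proof. by move=> [x y]; exact: cvg_snd. Qed.

Lemma mul_continuous (G : topologicalGroupType) (T : topologicalType)
    (f g : T -> G) :
  continuous f -> continuous g -> continuous (fun x => f x * g x)%g.
Proof.
move=> cf cg x.
apply: (@continuous2_cvg _ _ _ _ _ _ f g (fun a b : G => a * b)%g (f x) (g x)).
- exact: (@mulg_continuous G (f x, g x)).
- exact: cf.
- exact: cg.
Qed.

Lemma inv_continuous (G : topologicalGroupType) (T : topologicalType)
    (f : T -> G) :
  continuous f -> continuous (fun x => (f x)^-1)%g.
Proof.
move=> cf x; apply: (@continuous_comp _ _ _ f (fun a : G => a^-1)%g).
  exact: cf.
exact: invg_continuous.
Qed.

Section tidying.
Variables (G : topologicalGroupType) (phi : UMagmaMorphism.type G G).
Hypotheses (hG : hausdorff_space G) (cphi : continuous phi).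
Implicit Types (A B H K U V W : set G) (x y z : G).
Local Open Scope group_scope.
Local Notation cosg := (@compact_open_subgroup G).

Lemma relindexS A B A' B' : cosg A -> cosg A' -> is_subgroup B ->
  is_subgroup B' -> open B -> open B' -> A `<=` A' -> A `&` B' `<=` B ->
  (relindex A B <= relindex A' B')%N.
Proof.
move=> cA cA' sB sB' oB oB' AA' BB'; have [sA _ _] := cA.
have [||//] := @relindex_inj G A B A' B' id cA cA' sB sB' oB oB'.
  by move=> a; exact: AA'.
by move=> a b Aa Ab Bab; apply: BB'; split=> //; exact: (subVMg sA).
Qed.

Lemma relindexI_le A A' B B' : cosg A -> cosg A' -> is_subgroup B ->
  is_subgroup B' -> open B -> open B' ->
  (relindex (A `&` A') (B `&` B') <= relindex A B * relindex A' B')%N.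
Proof.
move=> cA cA' sB sB' oB oB'; have [sA _ oA] := cA; have [sA' _ oA'] := cA'.
have cAA' := cosgI cA sA' oA'.
rewrite relindexM //; apply: leq_mul; apply: relindexS => //.
  exact: cosgI.
by move=> x [[]].
Qed.

Local Notation "n .-pre U" := (iter n phi @^-1` U)
  (at level 2, format "n .-pre  U").

Lemma pre_subgroup n H : is_subgroup H -> is_subgroup (n.-pre H).
Proof. by move=> sH; exact: is_subgroup_preimage. Qed.

(** The growth of these indices does not depend on the subgroup, up to a constant. Refine by B, pass
    from A to B, then refine by phi^-n A: the last factor is at most [B : B /\ A] because phi^n
    embeds its cosets into those of B /\ A in B. *)
Lemma relindex_pre_le A B : cosg A -> cosg B ->
  exists C, forall n, (relindex A (n.-pre A) <= C * relindex B (n.-pre B))%N.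
Proof.
move=> cA cB; have [sA _ oA] := cA; have [sB _ oB] := cB.
exists (relindex A B * relindex B A)%N => n.
have sAn := pre_subgroup n sA; have oAn := open_iter_preimage cphi n oA.
have sBn := pre_subgroup n sB; have oBn := open_iter_preimage cphi n oB.
have sABn := is_subgroupI sBn sAn; have oABn := openI oBn oAn.
have le1 : (relindex A (n.-pre A) <=
            relindex A (B `&` (n.-pre B `&` n.-pre A)))%N.
  apply: relindexS => //;
    [exact: is_subgroupI|exact: openI|by move=> x [? [? []]]].
apply: leq_trans le1 _; rewrite relindexM // -mulnA; apply: leq_mul => //.
have le2 : (relindex (A `&` B) (n.-pre B `&` n.-pre A) <=
            relindex B (n.-pre B `&` n.-pre A))%N.
  by apply: relindexS => //; exact: cosgI.
apply: leq_trans le2 _; rewrite relindexM // mulnC; apply: leq_mul => //.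
have [|||//] := @relindex_inj G (B `&` n.-pre B) (n.-pre A) B A
  (iter n phi) _ cB sAn sA oAn oA.
- exact: cosgI.
- by move=> a [].
- by move=> a b _ _; rewrite -itergV -itergM.
Qed.

(** * Trajectories in a compact open subgroup, loops and tidy factorization *)

Section trajectories.
Variable U : set G.
Hypothesis cU : cosg U.
Let sU : is_subgroup U. Proof. by case: cU. Qed.

(** [minus] and [plus] are the groups U_- and U_+ of scale theory. [plus] only asks for finite
    backward trajectories of every length; [plus_surj] shows that they extend to infinite ones. *)
Definition minus : set G := \bigcap_n cotraj phi U n.
Definition plus : set G := \bigcap_n (iter n phi @` cotraj phi U n).

Lemma minus_subgroup : is_subgroup minus.
Proof.
apply/is_subgroupP; split=> [n _|x y Ux Uy n _].
  exact: (sub1g (cotraj_subgroup phi n sU)).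
by apply: (subFg (cotraj_subgroup phi n sU)); [exact: Ux|exact: Uy].
Qed.

Lemma minus_phi x : minus x -> minus (phi x).
Proof. by move=> Ux n _; apply: (@cotraj_iter _ _ U 1%N); exact: Ux. Qed.

Lemma minus_iter n x : minus x -> minus (iter n phi x).
Proof. by move=> Ux; elim: n => // n IH; exact: minus_phi. Qed.

Lemma minus_sub x : minus x -> U x.
Proof. by move=> /(_ 0%N I); rewrite cotraj0. Qed.

Lemma plus_subgroup : is_subgroup plus.
Proof.
have sn n : is_subgroup (iter n phi @` cotraj phi U n).
  exact/is_subgroup_image/cotraj_subgroup.
apply/is_subgroupP; split=> [n _|x y Ux Uy n _]; first exact: (sub1g (sn n)).
by apply: (subFg (sn n)); [exact: Ux|exact: Uy].
Qed.

Lemma plus_sub x : plus x -> U x.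
Proof. by move=> /(_ 0%N I)[y Uy <-]; exact: cotraj_sub Uy. Qed.

Lemma iter_cotraj_compact n : compact (iter n phi @` cotraj phi U n).
Proof.
apply: continuous_compact; last by have [] := cosg_cotraj cphi n cU.
exact/continuous_subspaceT/iter_continuous.
Qed.

Lemma iter_cotraj_decr n :
  iter n.+1 phi @` cotraj phi U n.+1 `<=` iter n phi @` cotraj phi U n.
Proof.
move=> _ [x Ux <-]; exists (phi x); last by rewrite iterSr.
exact: (@cotraj_iter _ _ U 1%N).
Qed.

(** A backward trajectory of length n + 1 provides a preimage of y in phi^n(U_{-n}), and compactness
    selects one preimage that serves all n. *)
Lemma plus_surj y : plus y -> exists2 z, plus z & phi z = y.
Proof.
move=> Uy; apply: (image_bigcap_compact hG hG cphi iter_cotraj_compact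
  iter_cotraj_decr) => n.
have [x Ux xy] := Uy n.+1 I; exists (iter n phi x) => //.
by exists x => //; exact: cotraj_le Ux.
Qed.

Lemma plus_phi z : plus z -> U (phi z) -> plus (phi z).
Proof.
move=> Uz Uphi [|n] _; first by exists (phi z); rewrite ?cotraj0.
have [x Ux xz] := Uz n I; exists x; last by rewrite -xz.
by rewrite cotrajS; split=> //=; rewrite xz.
Qed.

Lemma plus_iter n y : plus y ->
  exists z, [/\ plus z, cotraj phi U n z & iter n phi z = y].
Proof.
move=> Uy; elim: n => [|n [z [Uz Unz zy]]].
  by exists y; rewrite cotraj0; split=> //; exact: plus_sub.
have [x Ux xz] := plus_surj Uz; exists x; split=> //; last by rewrite iterSr xz.
apply: (@cotrajD _ _ U 1%N); last by rewrite /= xz.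
by apply/cotrajP => -[|[|//]] _ /=; [exact: plus_sub|rewrite xz;
  exact: plus_sub].
Qed.

(* Points with a backward trajectory in U and whose forward trajectory ends up
   in U; [loops] are the points of G with the same two asymptotic properties. *)
Definition loops0 : set G := [set x | plus x /\ exists n, minus (iter n phi x)].
Definition loops : set G := \bigcup_m (iter m phi @` loops0).

Lemma loops0_subgroup : is_subgroup loops0.
Proof.
have sp := plus_subgroup; have sm := minus_subgroup.
apply/is_subgroupP; split.
  by split; [exact: (sub1g sp)|exists 0%N; exact: (sub1g sm)].
move=> x y [Ux [n xn]] [Uy [m ym]]; split; first exact: (subFg sp).
exists (m + n)%N; rewrite itergF; apply: (subFg sm).
  by rewrite iterD; exact: minus_iter.
by rewrite addnC iterD; exact: minus_iter.
Qed.

Lemma loops0_surj x : loops0 x -> exists2 y, loops0 y & phi y = x.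
Proof.
move=> [Ux [n xn]]; have [y Uy yx] := plus_surj Ux; exists y => //; split=> //.
by exists n.+1; rewrite iterSr yx.
Qed.

Lemma loops0_phi x : loops0 x -> U (phi x) -> loops0 (phi x).
Proof.
move=> [Ux [n xn]] Uphi; split; first exact: plus_phi.
by exists n; rewrite -iterSr; exact: minus_phi.
Qed.

Lemma loops0_iter m x : loops0 x -> exists2 y, loops0 y & iter m phi y = x.
Proof.
move=> Lx; elim: m => [|m [y Ly yx]]; first by exists x.
by have [z Lz zy] := loops0_surj Ly; exists z => //; rewrite iterSr zy.
Qed.

Lemma loops_subgroup : is_subgroup loops.
Proof.
have s0 := loops0_subgroup; apply/is_subgroupP; split.
  by exists 0%N => //; exists 1 => //; exact: (sub1g s0).
move=> _ _ [m _ [x Lx <-]] [n _ [y Ly <-]].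
(* Going backwards inside [loops0] brings both elements to the common exponent [m + n]. *)
have [x' Lx' xx'] := loops0_iter n Lx; have [y' Ly' yy'] := loops0_iter m Ly.
exists (m + n)%N => //; exists (x' / y'); first exact: (subFg s0).
by rewrite itergF {2}addnC !iterD xx' yy'.
Qed.

Lemma loops_phi x : loops x -> loops (phi x).
Proof. by move=> [m _ [y Ly <-]]; exists m.+1 => //; exists y. Qed.

Lemma loops_iter n x : loops x -> loops (iter n phi x).
Proof. by move=> Lx; elim: n => // n IH; exact: loops_phi. Qed.

(* [phi loops0] is a finite union of cosets [x loops0] and the representatives
   [x] enter [minus] at a common time [N]. *)
Lemma loops_bounded : exists N, forall x, loops x ->
  exists u v, [/\ U u, U v & x = u * iter N phi v].
Proof.
have [_ cptU oU] := cU; have s0 := loops0_subgroup.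
have [I [f [f0 _ fs]]] : finite_index (phi @` loops0) U.
  apply: (@finite_index_compact _ (phi @` U)) => //.
  - by apply: continuous_compact => //; exact: continuous_subspaceT.
  - by move=> _ [x [Ux _] <-]; exists x => //; exact: plus_sub.
  - exact: is_subgroup_image.
have fN i : exists n, minus (iter n phi (f i)).
  have [x [_ [n xn]] <-] := f0 i; exists n.
  by rewrite -iterSr; exact: minus_phi.
have [t tP] := choice fN; pose N := \max_i t i.
have NP i n : (N <= n)%N -> minus (iter n phi (f i)).
  move=> Nn; have tn : (t i <= n)%N by apply: leq_trans Nn; exact: leq_bigmax.
  by rewrite -(subnK tn) iterD; exact/minus_iter/tP.
(* Each application of phi splits off a representative [f i], whose iterates lie in [minus] from
   time [N] on; these factors accumulate in [u]. *)
have step m x : loops0 x -> exists u v,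
    [/\ minus u, loops0 v & iter (m + N) phi x = u * iter N phi v].
  elim: m x => [|m IH] x Lx.
    by exists 1, x; rewrite mul1g; split=> //; exact: (sub1g minus_subgroup).
  have [i Ui] := fs (phi x) (imageP _ Lx).
  have [y Ly yx] : exists2 y, loops0 y & phi x = f i * y.
    (* This element is the image of [z^-1 * x] and lies in U, so [loops0_phi] applies. *)
    exists ((f i)^-1 * phi x); last by rewrite mulVKg.
    have [z Lz zf] := f0 i; rewrite -zf -gmulfV -gmulfM; apply: loops0_phi.
      exact: subVMg.
    by rewrite gmulfM gmulfV zf.
  have [u [v [Uu Lv uv]]] := IH y Ly.
  exists (iter (m + N) phi (f i) * u), v; split=> //.
    apply: (subMg minus_subgroup) => //.
    by apply: NP; rewrite leq_addl.
  by rewrite addSn iterSr yx itergM uv mulgA.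
exists N => x [m _ [y Ly <-]].
have [z Lz zy] := loops0_iter N Ly.
have [u [v [Uu Lv uv]]] := step m z Lz.
exists u, v; split; first exact: minus_sub.
  by have [/plus_sub] := Lv.
by rewrite -uv iterD zy.
Qed.

(** With L = [loops], this is the intersection of the conjugates l U l^-1, the subgroup U'
    normalized by L; [loop_hull] is the product V = U' L. *)
Definition loop_core : set G := [set x | forall l, loops l -> U (l^-1 * x * l)].

Lemma loop_coreJ x l : loop_core x -> loops l -> loop_core (l^-1 * x * l).
Proof.
move=> Ux Ll k Lk; have := Ux (l * k) (subMg loops_subgroup Ll Lk).
by rewrite invgM !mulgA.
Qed.

Lemma loop_core_subgroup : is_subgroup loop_core.
Proof.
apply/is_subgroupP; split=> [l _|x y Ux Uy l Ll].
  by rewrite mulg1 mulVg; exact: sub1g.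
have -> : l^-1 * (x / y) * l = (l^-1 * x * l) / (l^-1 * y * l).
  by rewrite !invgM invgK !mulgA mulgK.
by apply: subFg => //; [exact: Ux|exact: Uy].
Qed.

Lemma loop_core_sub x : loop_core x -> U x.
Proof.
move=> /(_ 1); rewrite invg1 mul1g mulg1; apply.
exact: (sub1g loops_subgroup).
Qed.

Definition bounded_set N : set G :=
  (fun p : G * G => p.1 * iter N phi p.2) @` (U `*` U).

Lemma bounded_set_compact N : compact (bounded_set N).
Proof.
have [_ cptU _] := cU; apply: continuous_compact; last exact: compact_setX.
apply: continuous_subspaceT; apply: mul_continuous; first exact: fst_continuous.
move=> p; apply: (@continuous_comp _ _ _ snd (iter N phi)).
  exact: snd_continuous.
exact: iter_continuous.
Qed.

(** L lies in the compact set U phi^N(U). By continuity of conjugation and compactness, one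
    neighbourhood of 1 is conjugated into U by all elements of that set. *)
Lemma loop_core_open : open loop_core.
Proof.
have [_ _ oU] := cU; have [N NP] := loops_bounded.
apply: is_subgroup_open; first exact: loop_core_subgroup.
have /compact_near_coveringP cM := @bounded_set_compact N.
have : nbhs (1 : G) [set x | bounded_set N `<=` [set m | U (m^-1 * x * m)]].
  apply: (cM _ _ (fun x m => U (m^-1 * x * m))) => m _.
  pose h (p : G * G) := p.1^-1 * p.2 * p.1.
  have ch : continuous h.
    apply: mul_continuous; last exact: fst_continuous.
    apply: mul_continuous; last exact: snd_continuous.
    apply: inv_continuous; exact: fst_continuous.
  have : nbhs (m, 1 : G) (h @^-1` U).
    apply: ch; apply: open_nbhs_nbhs; split=> //.
    by rewrite /h /= mulg1 mulVg; exact: sub1g.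
  by [].
apply: filterS => x Ux l /NP[u [v [Uu Uv lE]]]; apply: Ux.
by exists (u, v).
Qed.

Definition loop_hull : set G :=
  [set x | exists u l, [/\ loop_core u, loops l & x = u * l]].

Lemma loop_core_hull x : loop_core x -> loop_hull x.
Proof.
move=> Ux; exists x, 1; split; rewrite ?mulg1 //; exact: (sub1g loops_subgroup).
Qed.

Lemma loop_hull_subgroup : is_subgroup loop_hull.
Proof.
apply/is_subgroupP; split.
  exact/loop_core_hull/(sub1g loop_core_subgroup).
move=> _ _ [u [l [Uu Ll ->]]] [v [k [Uv Lk ->]]].
exists (u * ((l / k) * v^-1 * (l / k)^-1)), (l / k); split.
- apply: (subMg loop_core_subgroup) => //.
  have := @loop_coreJ v^-1 (l / k)^-1; rewrite invgK; apply.
    exact: (subVg loop_core_subgroup).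
  by apply: (subVg loops_subgroup); exact: (subFg loops_subgroup).
- exact: (subFg loops_subgroup).
- by rewrite -[RHS]mulgA mulgVK invgM !mulgA.
Qed.

(** V is closed, being an open subgroup, and lies in the compact product of U with
    [bounded_set N]. *)
Lemma loop_hull_cosg : cosg loop_hull.
Proof.
have [_ cptU oU] := cU.
have oH : open loop_hull.
  apply: is_subgroup_open; first exact: loop_hull_subgroup.
  apply: filterS loop_core_hull _; apply: open_nbhs_nbhs; split.
    exact: loop_core_open.
  exact: (sub1g loop_core_subgroup).
split=> //; first exact: loop_hull_subgroup.
have [N NP] := loops_bounded.
have cM : compact ((fun p : G * G => p.1 * p.2) @` (U `*` bounded_set N)).
  apply: continuous_compact.
    by apply: continuous_subspaceT; exact: mulg_continuous.
  by apply: compact_setX => //; exact: bounded_set_compact.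
apply: subclosed_compact cM _.
  by apply: is_subgroup_closed => //; exact: loop_hull_subgroup.
move=> _ [u [l [Uu Ll ->]]]; exists (u, l) => //; split=> /=.
  exact: loop_core_sub.
by have [a [b [Ua Ub ->]]] := NP _ Ll; exists (a, b).
Qed.

(* U is tidy above in the sense of Willis. *)
Hypothesis tidyU : forall m,
  displacement phi (cotraj phi U m) = displacement phi U.

(** A counting argument: phi^n injects U_{-n} / U_{-2n} into U / U_{-n}, and tidiness makes both
    indices equal to the n-th power of the displacement, so the injection is onto. *)
Lemma tidy_factor_iter n x : U x -> exists u v,
  [/\ cotraj phi U n u, cotraj phi U n v & x = iter n phi u * v].
Proof.
move=> Ux; have [_ _ oU] := cU.
have sn k := cotraj_subgroup phi k sU; have on k := cotraj_open cphi k oU.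
have cn k := cosg_cotraj cphi k cU.
have nn : cotraj phi U n `&` cotraj phi U (n + n) = cotraj phi U (n + n).
  by apply: setIidr; apply: cotraj_le; rewrite leq_addr.
have e : relindex (cotraj phi U n) (cotraj phi U (n + n)) =
    relindex U (cotraj phi U n).
  have := relindexM cU (sn n) (on n) (sn (n + n)%N) (on (n + n)%N).
  rewrite nn (setIidr (@cotraj_sub _ phi U n)).
  rewrite !(relindex_cotraj_const cphi _ cU tidyU) expnD => /eqP.
  rewrite eqn_pmul2l => [/eqP//|]; rewrite expn_gt0.
  by rewrite displacement_gt0.
have [||_ /(_ e x Ux)[u Uu Uv]] := @relindex_inj G (cotraj phi U n)
    (cotraj phi U (n + n)) U (cotraj phi U n) (iter n phi) (cn n) cU
    (sn _) (sn _) (on _) (on _).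
- by move=> a /(_ n); apply => /=.
- move=> a b Ua Ub; rewrite -itergV -itergM; apply: cotrajD.
  exact: (subVMg (sn n)).
exists u, ((iter n phi u)^-1 * x); split=> //.
by rewrite mulVKg.
Qed.

(** Limit of [tidy_factor_iter]: multiplication maps the decreasing compact sets phi^n(U_{-n}) x
    U_{-n} onto sets containing x. *)
Lemma tidy_factor x : U x -> exists u v, [/\ plus u, minus v & x = u * v].
Proof.
move=> Ux.
have [||||||[u v] uv <-] := @image_bigcap_compact _ _
    (fun p : G * G => p.1 * p.2)
    (fun n => (iter n phi @` cotraj phi U n) `*` cotraj phi U n) x.
- exact: hausdorff_prod.
- exact: hG.
- exact: mulg_continuous.
- move=> n; apply: compact_setX; first exact: iter_cotraj_compact.
  by have [] := cosg_cotraj cphi n cU.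
- by move=> n [a b] [/iter_cotraj_decr ? Ub]; split=> //; exact: cotraj_le Ub.
- move=> n; have [u [v [Uu Uv ->]]] := tidy_factor_iter n Ux.
  by exists (iter n phi u, v) => //; split=> //=; exists u.
by exists u, v; split=> // n _; have [] := uv n I.
Qed.

(** Factor x = p q and phi^n(p)^-1 = a b along U_+ U_-, and lift a to z in U_+ and U_{-n} with
    phi^n(z) = a. Then p z is in U_+ and phi^n(p z) = b^-1 is in U_-, so p z is a loop, while z^-1 q
    stays in U up to time n. *)
Lemma tidy_excursion n x : U x -> U (iter n phi x) ->
  exists l z, [/\ loops l, cotraj phi U n z & x = l * z].
Proof.
move=> Ux Unx; have [p [q [Up Uq xE]]] := tidy_factor Ux.
have Up' : U (iter n phi p)^-1.
  apply: subVg => //.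
  have -> : iter n phi p = iter n phi x / iter n phi q.
    by rewrite xE itergM mulgK.
  by apply: subFg => //; exact/minus_sub/minus_iter.
have [a [b [Ua Ub abE]]] := tidy_factor Up'.
have [z [Uz Unz zE]] := plus_iter n Ua.
exists (p * z), (z^-1 * q); split; last by rewrite mulgA mulgK.
  exists 0%N => //; exists (p * z) => //; split.
    exact: (subMg plus_subgroup).
  exists n; rewrite itergM zE.
  have -> : iter n phi p = b^-1 * a^-1 by rewrite -invgM -abE invgK.
  by rewrite mulgVK; apply: (subVg minus_subgroup).
exact: (subVMg (cotraj_subgroup phi n sU) Unz (Uq n I)).
Qed.

End trajectories.

(** * Growth bounds and intersections of minimizing subgroups *)

Lemma loops_sub U W : U `<=` W -> loops U `<=` loops W.
Proof.
move=> UW; have Un n : cotraj phi U n `<=` cotraj phi W n.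
  by move=> x Ux i ni; exact/UW/Ux.
have Um : minus U `<=` minus W by move=> x Ux n _; exact/Un/Ux.
move=> _ [m _ [x [Ux [n xn]] <-]]; exists m => //; exists x => //; split.
  by move=> k _; have [y Uy <-] := Ux k I; exists y => //; exact: Un.
by exists n; exact: Um.
Qed.

(** Take W of least displacement among the compact open subgroups of H: W_{-m} is again one of them,
    and its displacement is not larger. *)
Lemma tidy_exists H : is_subgroup H -> open H -> (exists2 U, cosg U &
  U `<=` H) ->
  exists W, [/\ cosg W, W `<=` H &
    forall m, displacement phi (cotraj phi W m) = displacement phi W].
Proof.
move=> sH oH [U cU UH].
pose P n := `[< exists W, [/\ cosg W, W `<=` H & displacement phi W = n] >].
have exP : exists n, P n by exists (displacement phi U); apply/asboolP;
  exists U.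
case: (ex_minnP exP) => n /asboolP[W [cW WH <-]] min.
exists W; split=> // m; have cWm := cosg_cotraj cphi m cW.
apply/eqP; rewrite eqn_leq; apply/andP; split.
  by rewrite -[X in (_ <= displacement _ X)%N](cotraj0 phi);
    exact: displacement_cotraj_ge.
apply: min; apply/asboolP; exists (cotraj phi W m); split=> //.
by move=> x /cotraj_sub/WH.
Qed.

Lemma expn_scale_le_pre U : cosg U ->
  exists C, forall n, (scale phi ^ n <= C * relindex U (n.-pre U))%N.
Proof.
move=> cU; have [sU _ oU] := cU; set V := loop_hull U.
have cV : cosg V := loop_hull_cosg cU; have [sV _ oV] := cV.
have sc := loop_core_subgroup cU; have oc : open (loop_core U) :=
  loop_core_open cU.
have [W [cW WU tW]] : exists W, [/\ cosg W, W `<=` loop_core U &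
    forall m, displacement phi (cotraj phi W m) = displacement phi W].
  apply: tidy_exists => //.
  exists (U `&` loop_core U); last by move=> x [].
  exact: cosgI.
have [sW _ oW] := cW.
have WV : W `<=` V by move=> x /WU; exact: loop_core_hull.
(* The loop factor keeps its whole orbit in L, and the other factor stays in W up to time n; both L
   and W lie in V. *)
have exc n x : W x -> n.-pre W x -> cotraj phi V n x.
  move=> Wx Wnx; have [l [z [Wl Wz ->]]] := tidy_excursion cW tW Wx Wnx.
  apply: (subMg (cotraj_subgroup phi n sV)).
    move=> i _ /=; exists 1, (iter i phi l); split.
    - exact: (sub1g sc).
    - apply: loops_iter; apply: loops_sub Wl => y /WU; exact: loop_core_sub.
    - by rewrite mul1g.
  by move=> i ni; exact/WV/(Wz i ni).
(* [C] compares V with U. The two factors [V : W] come from bounding [V /\ phi^-n V : V_{-n}] by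
   refining V /\ phi^-n V first by W and then by phi^-n W. *)
have [C CP] := relindex_pre_le cV cU.
exists (relindex V W * relindex V W * C)%N => n.
have sVn := pre_subgroup n sV; have oVn := open_iter_preimage cphi n oV.
have sWn := pre_subgroup n sW; have oWn := open_iter_preimage cphi n oW.
have scn := cotraj_subgroup phi n sV; have ocn := cotraj_open cphi n oV.
have cVn : cosg (V `&` n.-pre V) by exact: cosgI.
apply: leq_trans (expn_scale_le cphi n cV) _.
have -> : cotraj phi V n = n.-pre V `&` cotraj phi V n.
  by apply/esym/setIidr => x /(_ n); apply => /=.
rewrite relindexM // mulnC -mulnA; apply: leq_mul; last exact: CP.
apply: leq_trans (_ : (relindex (V `&` n.-pre V) (W `&` n.-pre W) <= _)%N).
  apply: relindexS => //; [exact: is_subgroupI|exact: openI|].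
  by move=> x [_ [Wx Wnx]]; exact: exc.
rewrite relindexM //; apply: leq_mul; first by apply: relindexS => // x [].
have [|||//] := @relindex_inj G (V `&` n.-pre V `&` W) (n.-pre W) V W
    (iter n phi) _ cV sWn sW oWn oW.
- exact: cosgI.
- by move=> a [[]].
- by move=> a b _ _; rewrite -itergV -itergM.
Qed.

(** The total index [U : U_{-n}] is exactly s^n, and its first factor [U : U /\ phi^-n U] already
    has this order of growth. *)
Lemma relindex_pre_cotraj_le U : minimizing phi U ->
  exists C, forall n, (relindex (U `&` n.-pre U) (cotraj phi U n) <= C)%N.
Proof.
move=> mU; have [cU _] := mU; have [sU _ oU] := cU.
have [C CP] := expn_scale_le_pre cU; exists C => n.
have sUn := pre_subgroup n sU; have oUn := open_iter_preimage cphi n oU.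
have scn := cotraj_subgroup phi n sU; have ocn := cotraj_open cphi n oU.
have := relindex_cotraj_minimizing cphi n mU.
have {1}-> : cotraj phi U n = n.-pre U `&` cotraj phi U n.
  by apply/esym/setIidr => x /(_ n); apply => /=.
rewrite relindexM // => e; have := CP n; rewrite -e mulnC leq_pmul2r //.
apply: relindex_gt0 => //; exact: cosg_finite_index.
Qed.

(** With W = U /\ V, some W_{-n} is minimizing. Otherwise each step multiplies the index by at least
    s + 1, whereas [relindex_pre_le] and the bounds for U and V only allow growth of order s^n. *)
Lemma minimizing_setI U V : minimizing phi U -> minimizing phi V ->
  exists2 W, minimizing phi W & W `<=` U `&` V.
Proof.
move=> mU mV; have [cU sE] := mU; have [cV _] := mV.
have [sU _ oU] := cU; have [sV _ oV] := cV.
have s0 : (0 < scale phi)%N by rewrite sE displacement_gt0.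
set W := U `&` V; have cW : cosg W by exact: cosgI.
have [sW _ oW] := cW.
suff [n nW] : exists n, (displacement phi (cotraj phi W n) <= scale phi)%N.
  have cWn := cosg_cotraj cphi n cW; exists (cotraj phi W n);
    last exact: cotraj_sub.
  by split=> //; apply/eqP; rewrite eqn_leq nW andbT; exact: scale_le.
apply: contrapT => /forallNP large.
have lower n : ((scale phi).+1 ^ n <= relindex W (cotraj phi W n))%N.
  elim: n => [|n IH]; last first.
    rewrite expnSr relindex_cotrajS //; apply: leq_mul => //.
    by rewrite ltnNge; apply/negP/large.
  have := cosg_cotraj cphi 0 cW => -[s0W _ o0W].
  rewrite expn0; apply: relindex_gt0 => //; exact: cosg_finite_index.
have [A AP] := relindex_pre_le cW cU.
have [B BP] := relindex_pre_cotraj_le mU; have [D DP] :=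
  relindex_pre_cotraj_le mV.
have upper n : (relindex W (cotraj phi W n) <= A * (B * D) * scale phi ^ n)%N.
  have sWn := pre_subgroup n sW; have oWn := open_iter_preimage cphi n oW.
  have sUn := pre_subgroup n sU; have oUn := open_iter_preimage cphi n oU.
  have sVn := pre_subgroup n sV; have oVn := open_iter_preimage cphi n oV.
  have -> : cotraj phi W n = n.-pre W `&` cotraj phi W n.
    by apply/esym/setIidr => x /(_ n); apply => /=.
  rewrite relindexM //; last 2 first.
  - exact: cotraj_subgroup.
  - exact: cotraj_open.
  have -> : cotraj phi W n = cotraj phi U n `&` cotraj phi V n.
    apply/seteqP; split=> [x Wx|x [Ux Vx] i ni].
      by split=> i ni; have [] := Wx i ni.
    by split; [exact: Ux|exact: Vx].
  have -> : W `&` n.-pre W = (U `&` n.-pre U) `&` (V `&` n.-pre V).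
    exact: setIACA.
  rewrite mulnAC; apply: leq_mul.
    apply: leq_trans (AP n) _; rewrite leq_mul2l; apply/orP; right.
    rewrite -(relindex_cotraj_minimizing cphi n mU); apply: relindexS => //.
    - exact: cotraj_subgroup.
    - exact: cotraj_open.
    - by move=> x [_ /(_ n)]; apply => /=.
  apply: leq_trans (leq_mul (BP n) (DP n)); apply: relindexI_le.
  - exact: cosgI.
  - exact: cosgI.
  - exact: cotraj_subgroup.
  - exact: cotraj_subgroup.
  - exact: cotraj_open.
  - exact: cotraj_open.
(* Bernoulli's inequality (1 + 1/s)^n >= 1 + n/s with denominators cleared. *)
have bernoulli (s n : nat) : (s ^ n * (s + n) <= s.+1 ^ n * s)%N.
  elim: n => [|n IH]; first by rewrite addn0.
  rewrite !expnS -!mulnA; apply: leq_trans (leq_mul (leqnn _) IH).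
  by rewrite mulnCA [leqRHS]mulnCA leq_mul2l; apply/orP; right; nia.
(* For this n the two bounds give s + C s <= C s, against s > 0. *)
pose C := (A * (B * D))%N; pose n := (C * scale phi)%N.
have := leq_trans (lower n) (upper n); rewrite -(leq_pmul2r s0).
move=> /(leq_trans (bernoulli (scale phi) n)).
rewrite -/C -mulnA mulnCA leq_pmul2l ?expn_gt0 ?s0 // /n.
by rewrite -[leqRHS]add0n leq_add2r leqNgt s0.
Qed.

End tidying.

(** * Minimizing subgroups and the nub *)

Section compact_open_sets.
Variable T : topologicalType.
Hypothesis hT : hausdorff_space T.
Implicit Types (A B C D U V : set T) (x y : T).

Lemma compact_avoid_point B x : compact B -> ~ B x ->
  exists2 N, nbhs x N & B `&` closure N = set0.
Proof.
move=> cB nBx.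
have [||||_ [N nN <-] BN] := @compact_directed T B (closure @` nbhs x) cB.
- by exists (closure setT), setT => //; exact: filterT.
- by move=> _ [N _ <-]; exact: closed_closure.
- move=> _ _ [N nN <-] [M nM <-]; exists (closure (N `&` M)).
    by exists (N `&` M) => //; exact: filterI.
  exact: closureI.
- apply/seteqP; split=> // y [By xy]; apply: nBx.
  have -> // : x = y; apply: hT => N M nN nM.
  exact: (xy _ (imageP _ nN)).
by exists N.
Qed.

(** The closures of the open neighbourhoods of A are directed, and by [compact_avoid_point] each
    point of B is left out by one of them. *)
Lemma compact_separated A B : compact A -> compact B -> A `&` B = set0 ->
  exists U V, [/\ open U, open V, A `<=` U, B `<=` V & U `&` V = set0].
Proof.
move=> cA cB AB.
have [||||_ [N [oN AN] <-] BN] := @compact_directed T B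
   (closure @` [set N | open N /\ A `<=` N]) cB.
- by exists (closure setT), setT => //; split=> //; exact: openT.
- by move=> _ [N _ <-]; exact: closed_closure.
- move=> _ _ [N [oN AN] <-] [M [oM AM] <-]; exists (closure (N `&` M)).
    exists (N `&` M) => //; split; first exact: openI.
    by move=> x Ax; split; [exact: AN|exact: AM].
  exact: closureI.
- apply/seteqP; split=> // y [By Ny].
  have nAy : ~ A y by move=> Ay; suff : set0 y by []; rewrite -AB.
  have [M nM AM] := compact_avoid_point cA nAy.
  have : closure (~` closure M) y.
    apply: Ny; exists (~` closure M) => //; split.
      by rewrite openC; exact: closed_closure.
    by move=> x Ax Mx; suff : set0 x by []; rewrite -AM.
  by move=> /(_ M nM)[x [nMx Mx]]; apply: nMx; exact: subset_closure.
exists N, (~` closure N); split=> //.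
- by rewrite openC; exact: closed_closure.
- by move=> x Bx Nx; suff : set0 x by []; rewrite -BN.
- by apply/seteqP; split=> // x [Nx]; apply; exact: subset_closure.
Qed.

(* The intersection of the relatively clopen neighbourhoods of a point in a
   compact set is connected, hence reduced to that point. *)
Lemma compact_open_nbhs x : totally_disconnected [set: T] ->
  locally_compact [set: T] -> exists K, [/\ compact K, open K & K x].
Proof.
move=> tdT lcT; have [C Cx [cC clC]] := lcT x I.
have {}Cx : nbhs x C by apply: (@filterS _ (nbhs x) _ [set y | setT y ->
  C y]) Cx => y; exact.
(* The relatively clopen parts of [C] containing [x]; their intersection [Q] is to be connected. *)
pose F := [set D | [/\ D x, D `<=` C, closed D & closed (C `\` D)]].
have FC : F C.
  by split=> //; [exact: nbhs_singleton|rewrite setDv; exact: closed0].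
have Fdir A B : F A -> F B -> exists2 E, F E & E `<=` A `&` B.
  move=> [Ax AC clA clCA] [Bx BC clB clCB]; exists (A `&` B) => //.
  split=> //; first by move=> y [/AC].
    exact: closedI.
  by rewrite setDIr; exact: closedU.
have Fcl A : F A -> closed A by case.
pose Q := \bigcap_(D in F) D.
have FQ B : closed B -> C `&` B `&` Q = set0 -> exists2 D, F D &
  C `&` B `&` D = set0.
  move=> clB; apply: compact_directed => //; last by exists C.
  exact: compact_closedI.
have Qcl : closed Q by exact: closed_bigI.
have Qx : Q x by move=> D [].
have QC : Q `<=` C by move=> y; apply.
have cQ E E' : Q = E `|` E' -> closure E `&` E' = set0 -> compact E.
  move=> QE EE'; have EQ : E `<=` Q by rewrite QE; exact: subsetUl.
  apply: subclosed_compact cC (subset_trans EQ QC).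
  apply/closure_id/seteqP; split; first exact: subset_closure.
  move=> y Ey; have : Q y by rewrite ((closure_id Q).1 Qcl);
    exact: (closureS EQ).
  by rewrite QE => -[//|E'y]; suff : set0 y by []; rewrite -EE'.
have conQ E E' : E x -> E' !=set0 -> Q = E `|` E' -> ~ separated E E'.
  move=> Ex [y E'y] QE [E1 E2].
  have cE := cQ _ _ QE E1.
  have cE' : compact E' by apply: (cQ E' E); rewrite 1?setUC 1?setIC.
  have EE' : E `&` E' = set0.
    by apply/seteqP; split=> // z [Ez E'z]; rewrite -E1; split=> //;
      exact: subset_closure.
  have [U [V [oU oV EU EV UV]]] := compact_separated cE cE' EE'.
  have [||D [Dx DC clD clCD] CD] := FQ (~` (U `|` V)).
  - by rewrite closedC; exact: openU.
  - apply/seteqP; split=> // z [[_ nz] Qz]; apply: nz.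
    by move: Qz; rewrite QE => -[/EU|/EV]; [left|right].
  have DUV z : D z -> ~ V z -> U z.
    move=> Dz nV; apply: contrapT => nU; suff : set0 z by [].
    by rewrite -CD; split=> //; split; [exact: DC|case].
  (* Inside D the complement of V is contained in U, so removing V leaves a relatively clopen set;
     it contains x but misses y. *)
  have FDV : F (D `&` ~` V).
    split.
    - split=> // Vx; suff : set0 x by []; rewrite -UV; split=> //; exact: EU.
    - by move=> z [/DC].
    - by apply: closedI => //; rewrite closedC.
    - have -> : C `\` (D `&` ~` V) = (C `\` D) `|` (C `&` ~` U).
        apply/seteqP; split=> z.
          move=> [Cz nz]; have [Dz|nDz] := pselect (D z); last by left.
          right; split=> // Uz; apply: nz; split=> // Vz.
          by suff : set0 z by []; rewrite -UV.
        move=> [[Cz nDz]|[Cz nUz]]; split=> // -[Dz nVz] //.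
        by apply: nUz; exact: DUV.
      by apply: closedU => //; apply: closedI => //; rewrite closedC.
  have : Q y by rewrite QE; right.
  by move=> /(_ _ FDV)[_]; apply; exact: EV.
have Q1 y : Q y -> y = x.
  suff cQ' : connected Q.
    move=> Qy; have := tdT x I; move=> /seteqP[/(_ y) h _]; apply: h.
    exact: (connected_component_max Qx).
  apply/connectedP => E [En0 QE sE].
  have : Q x by []; rewrite QE => -[Ex|Ex].
    exact: (conQ (E false) (E true)).
  by apply: (conQ (E true) (E false)) => //; [rewrite setUC|rewrite separatedC].
(* Since [Q] reduces to [x], some [D] lies in the interior of [C], where relatively clopen implies
   open in the whole space. *)
have [||D [Dx DC clD clCD] CD] := FQ (~` C°).
- by rewrite closedC; exact: open_interior.
- apply/seteqP; split=> // z [[_ nz] /Q1 zx]; apply: nz; rewrite zx.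
  exact: (nbhs_singleton (nbhs_interior Cx)).
exists D; split=> //; first exact: subclosed_compact cC DC.
have -> : D = C° `&` ~` (C `\` D).
  apply/seteqP; split=> z.
    move=> Dz; split; last by move=> -[].
    apply: contrapT => nz; suff : set0 z by []; rewrite -CD.
    by split=> //; split=> //; exact: DC.
  move=> [/interior_subset Cz nz]; apply: contrapT => nDz; exact: nz.
by apply: openI; [exact: open_interior|rewrite openC].
Qed.

End compact_open_sets.

(** * Existence of minimizing subgroups and neighbourhoods of the nub *)

Section nub.
Variables (G : topologicalGroupType) (phi : UMagmaMorphism.type G G).
Hypotheses (hG : hausdorff_space G) (tdG : totally_disconnected [set: G]).
Hypotheses (lcG : locally_compact [set: G]) (cphi : continuous phi).
Implicit Types (H K U V W : set G) (x y z : G).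
Local Open Scope group_scope.
Local Notation cosg := (@compact_open_subgroup G).

(** Van Dantzig's theorem: the stabilizer of a compact open neighbourhood K of 1 under left
    translation is contained in K, and is open because K is compact and open. *)
Lemma cosg_exists : exists U, cosg U.
Proof.
have [K [cK oK K1]] := compact_open_nbhs hG (1 : G) tdG lcG.
pose H := [set x | forall k, K k -> K (x * k) /\ K (x^-1 * k)].
have sH : is_subgroup H.
  apply/is_subgroupP; split=> [k Kk|x y Hx Hy k Kk];
    first by rewrite invg1 mul1g.
  by rewrite invgF -!mulgA; split; [apply Hx; apply Hy|apply Hy; apply Hx].
have oH : open H.
  apply: is_subgroup_open => //; have /compact_near_coveringP ncK := cK.
  have h : continuous (fun p : G * G => p.2 * p.1).
    by apply: mul_continuous; [exact: snd_continuous|exact: fst_continuous].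
  have h' : continuous (fun p : G * G => p.2^-1 * p.1).
    apply: mul_continuous; last exact: fst_continuous.
    by apply: inv_continuous; exact: snd_continuous.
  apply: (ncK _ _ (fun x k => K (x * k) /\ K (x^-1 * k))) => k Kk.
  have n1 : nbhs (k, 1 : G) ((fun p : G * G => p.2 * p.1) @^-1` K).
    by apply: h; apply: open_nbhs_nbhs; split=> //=; rewrite mul1g.
  have n2 : nbhs (k, 1 : G) ((fun p : G * G => p.2^-1 * p.1) @^-1` K).
    by apply: h'; apply: open_nbhs_nbhs; split=> //=; rewrite invg1 mul1g.
  exact: filterI n1 n2.
exists H; split=> //; apply: subclosed_compact cK _.
  exact: is_subgroup_closed.
by move=> x /(_ 1 K1); rewrite mulg1 => -[].
Qed.

Lemma minimizing_exists : exists U, minimizing phi U.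
Proof.
have [U cU] := cosg_exists; have [V cV dV] := scale_attained phi cU.
by exists V; split.
Qed.

Lemma nub_sub_open K : open K -> nub phi `<=` K ->
  exists2 U, minimizing phi U & U `<=` K.
Proof.
move=> oK nK; have [U0 mU0] := minimizing_exists.
have [[sU0 cU0 oU0] _] := mU0.
have [|||||U mU UK] := @compact_directed _ (U0 `&` ~` K) (minimizing phi).
- by apply: compact_closedI => //; rewrite closedC.
- by exists U0.
- by move=> U [[sU _ oU] _]; exact: is_subgroup_closed.
- by move=> U V mU mV; exact: (minimizing_setI hG).
- by apply/seteqP; split=> // x [[_ nKx] nx]; apply: nKx; exact: nK.
(* Compactness only says that U avoids the part of [U0] outside K, hence the further intersection
   with [U0]. *)
have [W mW WU] := minimizing_setI hG cphi mU mU0.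
exists W => // x /WU[Ux U0x]; apply: contrapT => nKx.
by suff : set0 x by []; rewrite -UK.
Qed.

(** K contains a minimizing U by [nub_sub_open], and U_{-n} is contained in K_{-n}, so C = [K : U]
    works. *)
Lemma relindex_cotraj_nub K : cosg K -> nub phi `<=` K ->
  exists C, forall n, (relindex K (cotraj phi K n) <= C * scale phi ^ n)%N.
Proof.
move=> cK nK; have [sK _ oK] := cK; have [U mU UK] := nub_sub_open oK nK.
have [cU _] := mU; have [sU _ oU] := cU.
exists (relindex K U) => n; rewrite -(relindex_cotraj_minimizing cphi n mU).
have sUn := cotraj_subgroup phi n sU; have oUn := cotraj_open cphi n oU.
rewrite -[X in (_ * relindex X _)%N](setIidr UK) -relindexM //.
apply: relindexS => //.
- exact: cotraj_subgroup.
- exact: is_subgroupI.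
- exact: cotraj_open.
- exact: openI.
- by move=> x [_ [_ Ux]] i ni; exact/UK/Ux.
Qed.

End nub.

(** * Entropy of the induced map *)

Section growth_rate.
Local Open Scope ring_scope.

Lemma growth_rate_cvg (R : realType) (q : nat -> nat) (s C : nat) (m : R) :
  0 < m -> (0 < s)%N -> (forall n, (s ^ n <= q n <= C * s ^ n)%N) ->
  (- (n%:R^-1 * ln (m / (q n)%:R))) @[n --> \oo] --> ln (s%:R : R).
Proof.
move=> m0 s0 qP.
have C0 : (0 < C)%N.
  by have := qP 0%N; rewrite !expn0 muln1 => /andP[]; exact: leq_trans.
have sR : (s%:R : R) \is Num.pos by rewrite posrE ltr0n.
have CR : (C%:R : R) \is Num.pos by rewrite posrE ltr0n.
have qR n : ((q n)%:R : R) \is Num.pos.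
  rewrite posrE ltr0n; have /andP[+ _] := qP n; apply: leq_trans.
  by rewrite expn_gt0 s0.
have lnX n : ln ((s ^ n)%:R : R) = n%:R * ln s%:R.
  by rewrite natrX lnXn // mulr_natl.
have X0 n : ((s ^ n)%:R : R) \is Num.pos by rewrite posrE ltr0n expn_gt0 s0.
have n0 : (n%:R^-1 : R) @[n --> \oo] --> (0 : R).
  apply/gtr0_cvgV0; last exact: cvgr_idn.
  by exists 1%N => // n /=; rewrite ltr0n.
(* Both bounds of the squeeze have this form, with [c] equal to [- ln m] and to [ln C - ln m]. *)
have cv (c : R) : ln s%:R + n%:R^-1 * c @[n --> \oo] --> ln (s%:R : R).
  rewrite -[X in _ --> X]addr0 -[X in _ + X](mul0r c).
  by apply: cvgD; [exact: cvg_cst|exact: cvgMl].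
apply: (squeeze_cvgr _ (cv (- ln m)) (cv (ln C%:R - ln m))).
exists 1%N => // n /= n1; have /andP[lo up] := qP n.
have nR : 0 < (n%:R : R) by rewrite ltr0n.
rewrite ln_div ?qR ?posrE // -mulrN opprB.
have -> : ln s%:R = n%:R^-1 * ln ((s ^ n)%:R : R).
  by rewrite lnX mulKf // gt_eqF.
rewrite -!mulrDr !ler_pM2l ?invr_gt0 // lerD2r ler_ln // ler_nat lo /=.
rewrite addrA lerD2r -lnM // -natrM ler_ln ?ler_nat 1?mulnC //.
by rewrite posrE ltr0n muln_gt0 C0 -(ltr0n R) -posrE X0.
Qed.
End growth_rate.

(** * Saturated sets and the projection onto left cosets *)

Section coset_projection.
Variables (G : topologicalGroupType) (H : subgroup G).
Implicit Types (A B K : set G) (x y z g : G).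
Local Open Scope group_scope.
Local Notation pr := (@coset_proj G H).

(** Saturation: such an [A] is the full preimage of its projection. *)
Definition right_invariant A := forall x y, A x -> (H : set G) (x^-1 * y) ->
  A y.

Lemma right_invariant_subgroup K g : is_subgroup K -> H `<=` K ->
  right_invariant [set x | K (g^-1 * x)].
Proof.
move=> sK HK x y /= Kx /HK Kxy; rewrite -(mulVKg x y) mulgA.
exact: (subMg sK).
Qed.

Lemma coset_proj_surj q : exists x, pr x = q.
Proof. by exists (repr q); exact: reprK. Qed.

Lemma coset_proj_image A x : right_invariant A -> (pr @` A) (pr x) <-> A x.
Proof.
move=> rA; split=> [[y Ay /coset_projP/set_mem]|Ax]; last by exists x.
exact: rA.
Qed.

Lemma coset_proj_continuous : continuous pr.
Proof. exact: pi_continuous. Qed.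

Lemma coset_proj_open A : right_invariant A -> open A -> open (pr @` A).
Proof.
move=> rA oA; suff e : pr @^-1` (pr @` A) = A.
  by rewrite -{}e in oA; exact: oA.
by apply/seteqP; split=> x /(coset_proj_image _ rA).
Qed.

Lemma coset_translation_image A g :
  coset_translation g @` (pr @` A) = pr @` [set x | A (g^-1 * x)].
Proof.
apply/seteqP; split=> [_ [_ [x Ax <-] <-]|_ [x Ax <-]].
  exists (g * x); first by rewrite /= mulKg.
  by rewrite coset_translationE.
exists (pr (g^-1 * x)); first by exists (g^-1 * x).
by rewrite coset_translationE mulVKg.
Qed.

Lemma coset_proj_compact K : compact K -> compact (pr @` K).
Proof.
move=> cK; apply: continuous_compact => //.
exact/continuous_subspaceT/coset_proj_continuous.
Qed.

End coset_projection.

(** * Invariant measure and indices *)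

Section coset_measure.
Local Open Scope ring_scope.
Variables (R : realType) (G : topologicalGroupType) (H : subgroup G).
Variable mu : {measure set (borel_coset_space H) -> \bar R}.
Hypothesis mu_inv : invariant_coset_measure mu.
Implicit Types (A B K : set G) (x y z g : G).
Local Notation pr := (@coset_proj G H).

Lemma measurable_coset_open (A : set (borel_coset_space H)) :
  open (A : set (coset_space H)) -> measurable A.
Proof. by move=> oA; exact: sub_sigma_algebra. Qed.

Lemma measurable_coset_proj K : is_subgroup K -> open K -> H `<=` K ->
  measurable (pr @` K : set (borel_coset_space H)).
Proof.
move=> sK oK HK; apply: measurable_coset_open; apply: coset_proj_open => //.
have := @right_invariant_subgroup G H K 1%g sK HK.
by under eq_set do rewrite invg1 mul1g.
Qed.

Lemma open_coset_translate K g : is_subgroup K -> open K -> H `<=` K ->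
  open (coset_translation g @` (pr @` K)).
Proof.
move=> sK oK HK; rewrite coset_translation_image; apply: coset_proj_open.
  exact: right_invariant_subgroup.
exact: open_lcoset.
Qed.

(** As H lies in K', the translates of the image of K' by representatives of K / K' partition the
    image of K, and they have equal measure. *)
Lemma coset_measure_index K K' : compact_open_subgroup K -> is_subgroup K' ->
  open K' -> H `<=` K' -> K' `<=` K ->
  mu (pr @` K) = ((relindex K K')%:R%:E * mu (pr @` K'))%E.
Proof.
move=> cK sK' oK' HK' K'K; have [sK _ oK] := cK.
have [I [f tf]] := cosg_finite_index cK sK' oK'.
rewrite (relindexE sK sK' tf); case: tf => [Kf fi fs].
have HK := subset_trans HK' K'K.
pose F (i : I) : set (borel_coset_space H) :=
  coset_translation (f i) @` (pr @` K').
have rK' g := @right_invariant_subgroup G H K' g sK' HK'.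
have -> : pr @` K = \bigcup_(i in [set: I]) F i.
  rewrite /F; under eq_bigcupr do rewrite coset_translation_image.
  apply/seteqP; split=> [_ [x Kx <-]|_ [i _ [x Kx <-]]].
    by have [i Ki] := fs _ Kx; exists i => //; exists x.
  exists x => //.
  by rewrite -(mulVKg (f i) x); apply: (subMg sK) => //; exact: K'K.
rewrite measure_fin_bigcup //.
- rewrite (_ : [set: I] = [set` enum I]); last first.
    by apply/seteqP; split=> // i _; rewrite /= mem_enum.
  rewrite -fsbig_seq ?enum_uniq //.
  rewrite (eq_bigr (fun=> mu (pr @` K'))) => [|i _]; last first.
    by have [inv _ _] := mu_inv; apply: inv; exact: measurable_coset_proj.
  by rewrite big_enum /= sumr_const mule_natl.
- exact: finite_finset.
- apply/trivIsetP => i j _ _ ij; apply/seteqP; split=> // q.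
  have [x <-] := coset_proj_surj q.
  rewrite /F !coset_translation_image => -[].
  move=> /(coset_proj_image _ (rK' _)) Kix /(coset_proj_image _ (rK' _)) Kjx.
  move/eqP: ij; apply; apply: fi.
  have -> : ((f i)^-1 * f j = ((f i)^-1 * x) * ((f j)^-1 * x)^-1)%g.
    by rewrite invgM invgK mulgA mulgK.
  exact: (subFg sK').
- by move=> i _; apply: measurable_coset_open; exact: open_coset_translate.
Qed.

Lemma coset_measure_fin K : compact K -> (mu (pr @` K) < +oo)%E.
Proof.
by move=> cK; have [_ fin _] := mu_inv; apply: fin; exact: coset_proj_compact.
Qed.

(** Otherwise finitely many null translates would cover a compact set of positive measure. The
    Hausdorff property makes that set closed, hence measurable. *)
Lemma coset_measure_gt0 K : hausdorff_space (coset_space H) ->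
  is_subgroup K -> open K -> H `<=` K -> (0 < mu (pr @` K))%E.
Proof.
move=> hH sK oK HK; have [inv _ [C cC C0]] := mu_inv.
rewrite lt0e measure_ge0 andbT; apply/eqP => mu0.
have : cover_compact C by rewrite -compact_cover.
pose F g := coset_translation g @` (pr @` K).
move=> /(_ G setT F) [].
- by move=> g _; exact: open_coset_translate.
- move=> q _; have [x <-] := coset_proj_surj q; exists x => //.
  rewrite /F coset_translation_image; exists x => //=.
  by rewrite mulVg; exact: sub1g.
move=> D _ CD; move: C0; rewrite ltNge => /negP; apply.
apply: le_trans (content_sub_fsum mu _ _ _ CD) _.
- exact: finite_fset.
- by move=> g _; apply: measurable_coset_open; exact: open_coset_translate.
- rewrite -[C]setCK; apply: measurableC; apply: measurable_coset_open.
  by rewrite openC; exact: compact_closed.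
- rewrite fsbig1 // => g _; apply: etrans (inv g _ _) mu0;
    exact: measurable_coset_proj.
Qed.

End coset_measure.

Section coset_dynamics.
Variables (G : topologicalGroupType) (H : subgroup G).
Local Notation pr := (@coset_proj G H).

(** The images of x U and y U separate the two points. For the nub, the minimizing subgroups supply
    U. *)
Lemma coset_hausdorff :
  (forall x, ~ (H : set G) x ->
    exists U, [/\ is_subgroup U, open U, H `<=` U & ~ U x]) ->
  hausdorff_space (coset_space H).
Proof.
move=> sep; rewrite open_hausdorff => p q.
have [x <-] := coset_proj_surj p; have [y <-] := coset_proj_surj q => /eqP pq.
have [|U [sU oU HU nU]] := sep (x^-1 * y)%g.
  by move=> Hxy; apply: pq; apply/coset_projP; exact/mem_set.
pose F g := pr @` [set z | U (g^-1 * z)%g].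
have rU g := @right_invariant_subgroup G H U g sU HU.
have Fx g : F g (pr g).
  by exists g => //=; rewrite mulVg; exact: sub1g.
exists (F x, F y); first by split; exact/mem_set/Fx.
split; try by apply: coset_proj_open => //; exact: open_lcoset.
apply/eqP/seteqP; split=> // z; have [w <-] := coset_proj_surj z.
move=> [/(coset_proj_image _ (rU x)) Ux /(coset_proj_image _ (rU y)) Uy].
apply: nU; have -> : (x^-1 * y = (x^-1 * w) / (y^-1 * w))%g.
  by rewrite invgM invgK mulgA mulgK.
exact: (subFg sU).
Qed.

Lemma cotrajectory_proj (phi : UMagmaMorphism.type G G) K n :
  phi @` H `<=` H -> is_subgroup K -> H `<=` K ->
  cotrajectory (coset_map (H := H) phi) (pr @` K) n = pr @` (cotraj phi K n).
Proof.
move=> phiH sK HK.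
have iterE i x : iter i (coset_map (H := H) phi) (pr x) = pr (iter i phi x).
  by elim: i => //= i ->; exact: coset_map_morphE.
have rK : right_invariant H K.
  by move=> x y Kx /HK Kxy; rewrite -(mulVKg x y); exact: (subMg sK).
apply/seteqP; split=> [q|_ [x Kx <-] i ni].
  have [x <-] := coset_proj_surj q => Kx; exists x => // i ni.
  by have := Kx i ni; rewrite /= iterE => /(coset_proj_image _ rK).
by rewrite /= iterE; exists (iter i phi x) => //; exact: Kx.
Qed.

End coset_dynamics.

Local Open Scope ring_scope.

(** The measure of the n-th cotrajectory is m / [K : K_{-n}], and this index lies between s^n and C
    s^n; the constants vanish in the limit, so the value does not depend on K. *)
Lemma entropy_at_nub (R : realType) (G : topologicalGroupType)
    (phi : UMagmaMorphism.type G G)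
    (mu : {measure set (borel_coset_space (nub_subgroup phi)) -> \bar R})
    (K : set G) :
  hausdorff_space G -> totally_disconnected [set: G] ->
  locally_compact [set: G] -> continuous phi -> invariant_coset_measure mu ->
  compact_open_subgroup K -> nub phi `<=` K ->
  entropy_at mu (coset_map (H := nub_subgroup phi) phi)
    (@coset_proj G (nub_subgroup phi) @` K) = (ln (scale phi)%:R)%:E.
Proof.
move=> hG tdG lcG cphi mu_inv cK nK; have [sK cptK oK] := cK.
have phin := nub_invariant cphi.
have hH : hausdorff_space (coset_space (nub_subgroup phi)).
  apply: coset_hausdorff => x nx.
  have [U mU nUx] : exists2 U, minimizing phi U & ~ U x.
    apply: contrapT => /forall2NP h; apply: nx => U mU.
    by have [//|/contrapT] := h U.
  have [[sU _ oU] _] := mU; exists U; split=> // y; exact.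
have [U0 [cU0 sU0]] := minimizing_exists phi hG tdG lcG.
have s0 : (0 < scale phi)%N by rewrite sU0 displacement_gt0.
have [C CP] := relindex_cotraj_nub hG tdG lcG cphi cK nK.
set A := _ @` K.
have A0 : (0 < mu A)%E by exact: coset_measure_gt0.
have Afin : mu A = (fine (mu A))%:E.
  by rewrite fineK // ge0_fin_numE ?measure_ge0 // coset_measure_fin.
set m := fine (mu A) in Afin.
have m0 : 0 < m by rewrite -lte_fin -Afin.
pose q n := relindex K (cotraj phi K n).
have sqC n : (scale phi ^ n <= q n <= C * scale phi ^ n)%N.
  by rewrite CP andbT; exact: expn_scale_le.
have q0 n : 0 < ((q n)%:R : R).
  by rewrite ltr0n; have /andP[+ _] := sqC n; apply: leq_trans;
    rewrite expn_gt0 s0.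
have nKn n : nub phi `<=` cotraj phi K n.
  move=> x nx i _ /=; apply: nK; elim: i => //= i IH; apply: phin.
  by exists (iter i phi x).
have muE n : mu (cotrajectory (coset_map (H := nub_subgroup phi) phi) A n) =
    (m / (q n)%:R)%:E.
  rewrite cotrajectory_proj //.
  have := coset_measure_index mu_inv cK (cotraj_subgroup phi n sK)
    (cotraj_open cphi n oK) (nKn n) (@cotraj_sub _ phi K n).
  rewrite -/A Afin -/(q n) => /esym/eqP.
  rewrite -[(q n)%:R]invrK eqe_pdivrMl; last by rewrite invr_eq0 gt_eqF.
  by move=> /eqP ->; rewrite !invrK -EFinM mulrC.
rewrite /entropy_at.
have -> : (fun n => - ((n%:R^-1)%:E *
    lne (mu (cotrajectory (coset_map (H := nub_subgroup phi) phi) A n))))%E =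
  (fun n => (- (n%:R^-1 * ln (m / (q n)%:R)))%:E).
  by apply/funext => n; rewrite muE lne_EFin ?divr_gt0 // -EFinM -EFinN.
have cv := growth_rate_cvg m0 s0 sqC.
have ecv : (- (n%:R^-1 * ln (m / (q n)%:R)))%:E @[n --> \oo] -->
    (ln (scale phi)%:R : R)%:E.
  by apply: cvg_EFin => //; exact: nearW.
by rewrite (cvg_limn_einf_sup ecv).2.
Qed.

Theorem proposition4p8 (R : realType) (G : topologicalGroupType)
    (phi : UMagmaMorphism.type G G)
    (mu : {measure set (borel_coset_space (nub_subgroup phi)) -> \bar R}) :
  hausdorff_space G ->
  totally_disconnected [set: G] ->
  locally_compact [set: G] ->
  continuous phi ->
  invariant_coset_measure mu ->
  (ln (scale phi)%:R)%:E =
    topological_entropy mu (coset_map (H := nub_subgroup phi) phi).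
Proof.
move=> hG tdG lcG cphi mu_inv; rewrite /topological_entropy.
have [U mU] := minimizing_exists phi hG tdG lcG; have [cU _] := mU.
have nU : nub phi `<=` U by move=> x; exact.
(* The supremum runs over a singleton: all values agree, and a minimizing subgroup, which contains
   the nub, shows that there is one. *)
rewrite (_ : [set _ | _ in _] = [set (ln (scale phi)%:R)%:E]) ?ereal_sup1 //.
apply/seteqP; split=> [_ [K [cK nK] <-]|_ ->].
  exact: entropy_at_nub.
by exists U => //; exact: entropy_at_nub.
Qed.
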